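(* Let $\sigma$ be a smooth strictly convex closed curve in $\mathbb{R}^2$ (that is, $\sigma\in\mathcal{D}^\infty_+$ with $\sigma(0)=\sigma(2\pi)$). Then $$\mathcal{E}_G[\sigma]=\int_{\sigma} \frac{|\nabla_\sigma \kappa_\sigma|^2}{4 \kappa^3_\sigma} - \frac{(2\pi)^2}{L(\sigma)^2}\frac{1}{ \kappa_\sigma} \; \mathrm{d}s + 2\pi\;\geq\; 0$$ and $$\mathcal{E}_G^*[\sigma]=\int_{\sigma} \frac{|\nabla_\sigma \kappa_\sigma|^2}{4 \kappa^2_\sigma}-\kappa^2_\sigma \; \mathrm{d}s + \frac{(2\pi)^2}{L(\sigma)}\;\geq\; 0.$$ In each of the two inequalities, equality holds if and only if $\sigma\in\mathcal{O}$.
   Context: $\mathbb{S}^1\subset\mathbb{R}^2$ is the unit circle with its standard orientation, $\theta$ is the angular coordinate with $\theta(\mathbf{e}_1)=0$, and $\pi:\mathbb{R}\to\mathbb{S}^1$, $\pi(x)=(\cos x,\sin x)$. A smooth degree-one curve is an immersion $\sigma:[0,2\pi]\to\mathbb{R}^2$ of the form $\sigma(t)=\mathbf{x}_\sigma+\frac{L(\sigma)}{2\pi}\int_0^t \mathbf{T}_\sigma(\pi(x))\,\mathrm{d}x$, where $\mathbf{T}_\sigma:\mathbb{S}^1\to\mathbb{S}^1$ (the unit tangent map) is a smooth map of degree one, $\mathbf{x}_\sigma\in\mathbb{R}^2$ is the base point and $L(\sigma)>0$ is the length. It is strictly convex if $\mathbf{T}_\sigma$ has a smooth inverse, and closed if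 $\sigma(0)=\sigma(2\pi)$. $\mathcal{D}^\infty_+$ denotes the set of smooth strictly convex degree-one curves. The length element is $\mathrm{d}s=\frac{L(\sigma)}{2\pi}\mathrm{d}\theta$. The geodesic curvature $\kappa_\sigma$ is regarded as a function on $\mathbb{S}^1$, determined by $\mathbf{T}_\sigma^*\mathrm{d}\theta=\frac{L(\sigma)}{2\pi}\kappa_\sigma\,\mathrm{d}\theta$ (it is positive for strictly convex $\sigma$). $\nabla_\sigma$ is the intrinsic (arclength) gradient, so $|\nabla_\sigma f|=\frac{2\pi}{L(\sigma)}|\partial_\theta f|$ for a function $f$ on $\mathbb{S}^1$. Integrals $\int_\sigma\cdots\mathrm{d}s$ are integrals over $\mathbb{S}^1$ against $\mathrm{d}s$. Let $\mathbf{T}_0(p)=-\sin(\theta(p))\mathbf{e}_1+\cos(\theta(p))\mathbf{e}_2$. For strictly convex $\sigma$, the induced diffeomorphism is $\phi_\sigma=\mathbf{T}_0^{-1}\circ\mathbf{T}_\sigma$. For $A\in\mathrm{SL}(2,\mathbb{R})$ let $\Gamma(A):\mathbb{S}^1\to\mathbb{S}^1$, $\Gamma(A)(\mathbf{x})=\frac{A\mathbf{x}}{|A\mathbf{x}|}$, and let $\mathrm{M\ddot{o}b}(\mathbb{S}^1)=\Gamma(\mathrm{SL}(2,\mathbb{R}))$. The family of ovals of Benguria and Loss is $\mathcal{O}=\{\sigma\in\mathcal{D}_+^\infty:\phi_\sigma\in\mathrm{M\ddot{o}b}(\mathbb{S}^1)\}$. *)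

(* Defs.v *)
From Stdlib Require Import Reals Lra ZArith Eqdep_dec.
From Coquelicot Require Import Coquelicot.
Open Scope R_scope.

Record S1 : Type := mkS1 {
  px : R;
  py : R;
  S1_eq : px ^ 2 + py ^ 2 = 1
}.

Lemma S1_ext (p q : S1) : px p = px q -> py p = py q -> p = q.
Proof.
destruct p as [x y e], q as [x' y' e']; simpl; intros Hx Hy; subst x' y'.
f_equal; apply UIP_dec; apply Req_EM_T.
Qed.

Lemma proj_eq (x : R) : cos x ^ 2 + sin x ^ 2 = 1.
Proof. generalize (sin2_cos2 x); unfold Rsqr; lra. Qed.

(* The covering map of the circle by the line, written pi in the literature. *)
Definition proj (x : R) : S1 := mkS1 (cos x) (sin x) (proj_eq x).

(* The branch of the angular coordinate with values in (- PI, PI].  It jumps at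
   (-1, 0), but it is only used in expressions that do not depend on the
   branch. *)
Definition theta (p : S1) : R :=
  if Rle_dec 0 (py p) then acos (px p) else - acos (px p).

Lemma proj_theta (p : S1) : proj (theta p) = p.
Proof.
destruct p as [x y e].
assert (Hx : -1 <= x <= 1) by nra.
apply S1_ext; unfold theta; simpl; destruct (Rle_dec 0 y) as [H | H].
- now apply cos_acos.
- rewrite cos_neg; now apply cos_acos.
- rewrite sin_acos by assumption.
  replace (1 - Rsqr x) with (Rsqr y) by (unfold Rsqr; lra).
  now apply sqrt_Rsqr.
- rewrite sin_neg, sin_acos by assumption.
  replace (1 - Rsqr x) with (Rsqr (- y)) by (unfold Rsqr; lra).
  rewrite sqrt_Rsqr; lra.
Qed.

(* Since proj is a local diffeomorphism, smoothness and derivatives on the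
   circle are read through proj. *)
Definition smooth_fun (f : S1 -> R) : Prop :=
  forall (n : nat) (x : R), ex_derive_n (fun t => f (proj t)) n x.

Definition smooth_map (F : S1 -> S1) : Prop :=
  smooth_fun (fun p => px (F p)) /\ smooth_fun (fun p => py (F p)).

Definition dtheta (f : S1 -> R) (p : S1) : R :=
  Derive (fun t => f (proj t)) (theta p).

Lemma proj_inj_shift (x y : R) : proj x = proj y ->
  forall h : R, proj (x + h) = proj (y + h).
Proof.
intros E h.
assert (Ec : cos x = cos y) by exact (f_equal px E).
assert (Es : sin x = sin y) by exact (f_equal py E).
apply S1_ext; simpl.
- now rewrite !cos_plus, Ec, Es.
- now rewrite !sin_plus, Ec, Es.
Qed.

Lemma dtheta_proj (f : S1 -> R) (x : R) :
  dtheta f (proj x) = Derive (fun t => f (proj t)) x.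
Proof.
unfold dtheta, Derive; f_equal; apply Lim_ext; intros h.
now rewrite (proj_inj_shift _ _ (proj_theta (proj x)) h), proj_theta.
Qed.

(* [pullback_dtheta F] is the function g with F^* dtheta = g dtheta, where the
   angular form dtheta is the restriction of x dy - y dx to the circle. *)
Definition pullback_dtheta (F : S1 -> S1) (p : S1) : R :=
  px (F p) * dtheta (fun q => py (F q)) p
  - py (F p) * dtheta (fun q => px (F q)) p.

Lemma pullback_dtheta_lift (F : S1 -> S1) (tau : R -> R) (x : R) :
  (forall t, proj (tau t) = F (proj t)) -> ex_derive tau x ->
  pullback_dtheta F (proj x) = Derive tau x.
Proof.
intros Hlift Hd; unfold pullback_dtheta; rewrite !dtheta_proj, <- Hlift.
assert (Ey : Derive (fun t => py (F (proj t))) x = Derive tau x * cos (tau x)).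
{ rewrite <- (Derive_ext (fun t => sin (tau t)))
    by (intros t; now rewrite <- Hlift).
  apply is_derive_unique; auto_derive; [exact Hd |].
  change (Derive (fun u => tau u) x) with (Derive tau x); ring. }
assert (Ex : Derive (fun t => px (F (proj t))) x = - (Derive tau x * sin (tau x))).
{ rewrite <- (Derive_ext (fun t => cos (tau t)))
    by (intros t; now rewrite <- Hlift).
  apply is_derive_unique; auto_derive; [exact Hd |].
  change (Derive (fun u => tau u) x) with (Derive tau x); ring. }
rewrite Ex, Ey.
simpl; generalize (proj_eq (tau x)); intros E.
transitivity (Derive tau x * (cos (tau x) ^ 2 + sin (tau x) ^ 2)); [ring |].
rewrite E; ring.
Qed.

Definition has_degree (F : S1 -> S1) (d : Z) : Prop :=
  exists tau : R -> R,
    (forall x, continuous tau x) /\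
    (forall x, proj (tau x) = F (proj x)) /\
    (forall x, tau (x + 2 * PI) = tau x + 2 * PI * IZR d).

(* A smooth degree-one curve, given by its base point, length and unit tangent
   map, all of which are determined by the immersion [curve_map]. *)
Record degree_one_curve : Type := mkCurve {
  base_point : R * R;
  arclength : R;
  tangent : S1 -> S1;
  arclength_pos : 0 < arclength;
  tangent_smooth : smooth_map tangent;
  tangent_degree : has_degree tangent 1
}.

(* Only the values for t in [0, 2 PI] are meaningful. *)
Definition curve_map (sigma : degree_one_curve) (t : R) : R * R :=
  (fst (base_point sigma)
     + arclength sigma / (2 * PI) * RInt (fun x => px (tangent sigma (proj x))) 0 t,
   snd (base_point sigma)
     + arclength sigma / (2 * PI) * RInt (fun x => py (tangent sigma (proj x))) 0 t).

Definition closed_curve (sigma : degree_one_curve) : Prop :=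
  curve_map sigma 0 = curve_map sigma (2 * PI).

Definition strictly_convex (sigma : degree_one_curve) : Prop :=
  exists G : S1 -> S1,
    smooth_map G /\
    (forall p, G (tangent sigma p) = p) /\
    (forall p, tangent sigma (G p) = p).

Definition curvature (sigma : degree_one_curve) (p : S1) : R :=
  2 * PI / arclength sigma * pullback_dtheta (tangent sigma) p.

Definition grad_norm (sigma : degree_one_curve) (f : S1 -> R) (p : S1) : R :=
  2 * PI / arclength sigma * Rabs (dtheta f p).

Definition curve_integral (sigma : degree_one_curve) (f : S1 -> R) : R :=
  RInt (fun x => f (proj x) * (arclength sigma / (2 * PI))) 0 (2 * PI).

Lemma T0_eq (t : R) : (- sin t) ^ 2 + cos t ^ 2 = 1.
Proof. generalize (proj_eq t); lra. Qed.

Definition T0 (p : S1) : S1 :=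
  mkS1 (- sin (theta p)) (cos (theta p)) (T0_eq (theta p)).

Lemma T0_inv_eq (p : S1) : py p ^ 2 + (- px p) ^ 2 = 1.
Proof. generalize (S1_eq p); lra. Qed.

Definition T0_inv (p : S1) : S1 := mkS1 (py p) (- px p) (T0_inv_eq p).

Lemma cos_theta (p : S1) : cos (theta p) = px p.
Proof. exact (f_equal px (proj_theta p)). Qed.

Lemma sin_theta (p : S1) : sin (theta p) = py p.
Proof. exact (f_equal py (proj_theta p)). Qed.

Lemma T0_invK (p : S1) : T0 (T0_inv p) = p.
Proof.
apply S1_ext; unfold T0; cbn [px py].
- rewrite sin_theta; simpl; ring.
- now rewrite cos_theta.
Qed.

Lemma T0K (p : S1) : T0_inv (T0 p) = p.
Proof.
apply S1_ext; unfold T0_inv, T0; cbn [px py].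
- apply cos_theta.
- rewrite sin_theta; ring.
Qed.

Definition induced_map (sigma : degree_one_curve) (p : S1) : S1 :=
  T0_inv (tangent sigma p).

(* The matrix with rows (m11, m12) and (m21, m22). *)
Record SL2 : Type := mkSL2 {
  m11 : R; m12 : R;
  m21 : R; m22 : R;
  SL2_det : m11 * m22 - m12 * m21 = 1
}.

Definition act_x (A : SL2) (p : S1) : R := m11 A * px p + m12 A * py p.
Definition act_y (A : SL2) (p : S1) : R := m21 A * px p + m22 A * py p.
Definition act_norm (A : SL2) (p : S1) : R := sqrt (act_x A p ^ 2 + act_y A p ^ 2).

Lemma Gamma_eq (A : SL2) (p : S1) :
  (act_x A p / act_norm A p) ^ 2 + (act_y A p / act_norm A p) ^ 2 = 1.
Proof.
assert (Hpos : 0 < act_x A p ^ 2 + act_y A p ^ 2).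
{ destruct (Rle_lt_dec (act_x A p ^ 2 + act_y A p ^ 2) 0) as [H | H]; [| exact H].
  exfalso.
  assert (Hx : act_x A p = 0) by nra.
  assert (Hy : act_y A p = 0) by nra.
  generalize (SL2_det A) (S1_eq p); intros D E.
  assert (Ex : px p = m22 A * act_x A p - m12 A * act_y A p).
  { unfold act_x, act_y.
    transitivity ((m11 A * m22 A - m12 A * m21 A) * px p); [rewrite D |]; ring. }
  assert (Ey : py p = m11 A * act_y A p - m21 A * act_x A p).
  { unfold act_x, act_y.
    transitivity ((m11 A * m22 A - m12 A * m21 A) * py p); [rewrite D |]; ring. }
  rewrite Hx, Hy in Ex, Ey; nra. }
assert (Hn : act_norm A p ^ 2 = act_x A p ^ 2 + act_y A p ^ 2).
{ unfold act_norm; rewrite pow2_sqrt; lra. }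
assert (Hn0 : act_norm A p <> 0).
{ apply Rgt_not_eq, sqrt_lt_R0; exact Hpos. }
transitivity ((act_x A p ^ 2 + act_y A p ^ 2) / act_norm A p ^ 2); [now field |].
rewrite <- Hn; now field.
Qed.

Definition Gamma (A : SL2) (p : S1) : S1 :=
  mkS1 (act_x A p / act_norm A p) (act_y A p / act_norm A p) (Gamma_eq A p).

Definition mobius (F : S1 -> S1) : Prop :=
  exists A : SL2, forall p, F p = Gamma A p.

Definition oval (sigma : degree_one_curve) : Prop :=
  strictly_convex sigma /\ mobius (induced_map sigma).

Definition E_G (sigma : degree_one_curve) : R :=
  curve_integral sigma (fun p =>
    grad_norm sigma (curvature sigma) p ^ 2 / (4 * curvature sigma p ^ 3)
    - (2 * PI) ^ 2 / arclength sigma ^ 2 * (1 / curvature sigma p))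
  + 2 * PI.

Definition E_G_star (sigma : degree_one_curve) : R :=
  curve_integral sigma (fun p =>
    grad_norm sigma (curvature sigma) p ^ 2 / (4 * curvature sigma p ^ 2)
    - curvature sigma p ^ 2)
  + (2 * PI) ^ 2 / arclength sigma.

(* Main.v *)
Require Import Defs.
From Stdlib Require Import Reals Lra ZArith Classical.
From Coquelicot Require Import Coquelicot.
Open Scope R_scope.

(* Let [tau] be the lift of the unit tangent map and [w = tau' > 0].  For
   increasing lifts [s], [th] of circle diffeomorphisms, put [m = sqrt (s' / th')]
   and let [h = m e^(i th)] be the planar curve of unit areal speed in the time
   [s].  The integral of [|dh/ds|^2 - |h|^2] against [ds] is E_G for
   [(s, th) = (id, tau)], and E_G^* up to the factor [2 PI / L] for
   [(s, th) = (tau, id)].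

   Closedness of the curve gives three parameters [x1 < x2 < x3 < x1 + PI] with
   [tau (x_i + PI) = tau x_i + PI] at which [tau' (x_i) - tau' (x_i + PI)]
   alternates in sign.  The six points [x_i], [x_i + PI] cut the circle into arcs of
   [s]-length less than [PI].  On each arc the integral is at least its value on
   the solution of [h'' + h = 0] with the same end values, and the sum of these
   six values is a quadratic form in the six numbers [m (x_i)], [m (x_i + PI)].
   Its part even under the antipode is a sum of squares, since the three angles
   add up to [PI]; its odd part is nonnegative because of the alternating signs.
   In the case of equality [h'' + h = 0] throughout, so that [h] is the image of
   the unit circle under a matrix of determinant 1. *)

(** * Calculus on intervals, up to the sharp energy bound for one scalar function *)

Lemma is_derive_incr (f df : R -> R) (a b : R) :
  (forall x, a <= x <= b -> is_derive f x (df x)) ->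
  (forall x, a <= x <= b -> 0 < df x) -> a < b -> f a < f b.
Proof.
intros Hf Hp Hab.
destruct (MVT_gen f a b df) as (c & Hc & E).
- intros x; rewrite Rmin_left, Rmax_right by lra; intros Hx; apply Hf; lra.
- intros x; rewrite Rmin_left, Rmax_right by lra; intros Hx.
  apply continuity_pt_filterlim, (ex_derive_continuous f); exists (df x); auto.
- rewrite Rmin_left, Rmax_right in Hc by lra.
  specialize (Hp c Hc); nra.
Qed.

(** A positive value of a continuous function persists on a short interval, whose integral is then
    positive, while the remaining pieces contribute at least 0. This makes the equality cases
    pointwise. *)
Lemma RInt_le_0_eq_0 (f : R -> R) (a b : R) : a < b ->
  (forall x, a <= x <= b -> continuous f x) ->
  (forall x, a <= x <= b -> 0 <= f x) ->
  RInt f a b <= 0 -> forall x, a <= x <= b -> f x = 0.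
Proof.
intros Hab Hc Hp HI.
assert (Hex : forall c d, a <= c -> c <= d -> d <= b -> ex_RInt f c d).
{ intros c d Hac Hcd Hdb; apply (ex_RInt_continuous (V := R_CompleteNormedModule)).
  intros x; rewrite Rmin_left, Rmax_right by lra; intros Hx; apply Hc; lra. }
destruct (classic (forall x, a <= x <= b -> f x = 0)) as [H | H]; [exact H |].
exfalso.
apply not_all_ex_not in H as [x0 H].
apply imply_to_and in H as [Hx0 H].
assert (Hf0 : 0 < f x0) by (specialize (Hp x0 Hx0); lra).
pose proof (Hc x0 Hx0) as Hcx.
destruct (Hcx _ (locally_ball (f x0) (mkposreal _ Hf0))) as [d Hd].
(* Clipping to [[a, b]] covers the case that [x0] is an endpoint; the radius [d / 2] keeps the
   closed subinterval inside the open ball. *)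
set (c1 := Rmax a (x0 - d / 2)); set (d1 := Rmin b (x0 + d / 2)).
assert (Hd0 := cond_pos d).
assert (H1 : a <= c1 /\ c1 < d1 /\ d1 <= b /\ x0 - d / 2 <= c1 /\ d1 <= x0 + d / 2).
{ unfold c1, d1, Rmax, Rmin; destruct (Rle_dec a _), (Rle_dec b _); lra. }
assert (I2 : 0 < RInt f c1 d1).
{ apply RInt_gt_0; [lra | |].
  - intros x Hx.
    assert (Hb : ball x0 d x).
    { change (Rabs (x - x0) < d); apply Rabs_def1; lra. }
    specialize (Hd x Hb); change (Rabs (f x - f x0) < f x0) in Hd.
    apply Rabs_def2 in Hd; lra.
  - intros x Hx; apply Hc; lra. }
assert (I1 : 0 <= RInt f a c1).
{ apply RInt_ge_0; [lra | apply Hex; lra | intros x Hx; apply Hp; lra]. }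
assert (I3 : 0 <= RInt f d1 b).
{ apply RInt_ge_0; [lra | apply Hex; lra | intros x Hx; apply Hp; lra]. }
assert (E1 : RInt f a c1 + RInt f c1 d1 = RInt f a d1)
  by (apply (RInt_Chasles (V := R_CompleteNormedModule)); apply Hex; lra).
assert (E2 : RInt f a d1 + RInt f d1 b = RInt f a b)
  by (apply (RInt_Chasles (V := R_CompleteNormedModule)); apply Hex; lra).
lra.
Qed.

Lemma RInt_periodic (f : R -> R) (T a : R) :
  (forall x, continuous f x) -> (forall x, f (x + T) = f x) ->
  RInt f a (a + T) = RInt f 0 T.
Proof.
intros Hc Hp.
assert (Hex : forall c d, ex_RInt f c d)
  by (intros c d; apply (ex_RInt_continuous (V := R_CompleteNormedModule)); auto).
assert (E1 : RInt f 0 a + RInt f a (a + T) = RInt f 0 (a + T))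
  by (apply (RInt_Chasles (V := R_CompleteNormedModule)); apply Hex).
assert (E2 : RInt f 0 T + RInt f T (a + T) = RInt f 0 (a + T))
  by (apply (RInt_Chasles (V := R_CompleteNormedModule)); apply Hex).
assert (E3 : RInt f T (a + T) = RInt f 0 a).
{ generalize (RInt_comp_lin (V := R_CompleteNormedModule) f 1 T 0 a).
  replace (1 * 0 + T) with T by ring; replace (1 * a + T) with (a + T) by ring.
  intros E; rewrite <- E by apply Hex.
  apply RInt_ext; intros x _; rewrite Hp; unfold scal; simpl; unfold mult; simpl.
  now rewrite !Rmult_1_l. }
lra.
Qed.

Lemma continuous_is_derive (f df : R -> R) (x : R) :
  is_derive f x (df x) -> continuous f x.
Proof. intros H; apply (ex_derive_continuous f); now exists (df x). Qed.

(** Decomposes the function along its outermost operation. Continuity of an inverse is only looked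
    up among the hypotheses, and is otherwise left as a goal. *)
Ltac cont := lazymatch goal with
  | |- continuous (fun y => @?u y + @?v y) _ =>
      apply (continuous_plus (V := R_NormedModule) u v); cont
  | |- continuous (fun y => @?u y - @?v y) _ =>
      apply (continuous_minus (V := R_NormedModule) u v); cont
  | |- continuous (fun y => @?u y * @?v y) _ =>
      apply (continuous_mult (K := R_AbsRing) u v); cont
  | |- continuous (fun y => - @?u y) _ =>
      apply (continuous_opp (V := R_NormedModule) u); cont
  | |- continuous (fun y => / @?u y) _ => auto
  | |- continuous (fun y => cos (@?u y)) _ =>
      apply (continuous_comp u cos); [cont | apply continuous_cos]
  | |- continuous (fun y => sin (@?u y)) _ =>
      apply (continuous_comp u sin); [cont | apply continuous_sin]
  | |- continuous (fun y => sqrt (@?u y)) _ =>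
      apply (continuous_comp u sqrt); [cont | apply continuous_sqrt]
  | |- _ => first [solve [auto] | apply continuous_const | apply continuous_id]
  end.

Ltac der f l H :=
  replace (Derive (fun y : R => f y) _) with l
    by (symmetry; apply is_derive_unique, H; auto).

(* [ring] and [field] do not see through the structures over [R] in which
   Coquelicot states its equalities. *)
Ltac eq_in_R := match goal with |- @eq _ ?u ?v => change (@eq R u v) end.

(* Completing the square with the calibration [tan (s - mid)], which solves the
   Riccati equation and is regular on an interval shorter than [PI]. *)
Lemma interval_energy (s ds f df : R -> R) (A B a b : R) :
  (forall x, is_derive s x (ds x)) -> (forall x, continuous ds x) ->
  (forall x, 0 < ds x) ->
  (forall x, is_derive f x (df x)) -> (forall x, continuous df x) ->
  a < b -> s b - s a < PI ->
  f a = A * cos (s a) + B * sin (s a) ->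
  f b = A * cos (s b) + B * sin (s b) ->
  let I := RInt (fun x => df x ^ 2 / ds x - f x ^ 2 * ds x) a b in
  let J := f b * (B * cos (s b) - A * sin (s b))
           - f a * (B * cos (s a) - A * sin (s a)) in
  J <= I /\
  (I <= J -> forall x, a <= x <= b ->
     f x = A * cos (s x) + B * sin (s x)
     /\ df x = ds x * (B * cos (s x) - A * sin (s x))).
Proof.
intros Hs Hcs Hps Hf Hcf Hab Hl Ha Hb I J.
(* Centring at the midpoint keeps [s x - mid] in [(- PI / 2, PI / 2)], where the cosine is
   positive. *)
set (mid := (s a + s b) / 2).
set (F := fun x => A * cos (s x) + B * sin (s x)).
set (G := fun x => B * cos (s x) - A * sin (s x)).
set (T := fun x => sin (s x - mid) / cos (s x - mid)).
(* With [g = f - F], the sum [F * G + 2 * G * g] is a primitive of the terms of [e] of degree at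
   most one in [g] and its derivative, and [- T * g ^ 2] completes the square in the quadratic
   terms. Hence [Phi] is a primitive of [e - k]. *)
set (Phi := fun x => 2 * G x * (f x - F x) + F x * G x - T x * (f x - F x) ^ 2).
set (k := fun x => (df x - ds x * G x + T x * ds x * (f x - F x)) ^ 2 / ds x).
set (e := fun x => df x ^ 2 / ds x - f x ^ 2 * ds x).
assert (Hmono : forall x, a <= x <= b -> s a <= s x <= s b).
{ intros x [H1 H2]; split.
  - destruct H1 as [H1 | <-]; [| lra]; left; apply (is_derive_incr s ds); auto.
  - destruct H2 as [H2 | ->]; [| lra]; left; apply (is_derive_incr s ds); auto. }
assert (Hcos : forall x, a <= x <= b -> 0 < cos (s x - mid)).
{ intros x Hx; specialize (Hmono x Hx); apply cos_gt_0; unfold mid; lra. }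
assert (HF : forall x, is_derive F x (ds x * G x)).
{ intros x; unfold F, G; auto_derive.
  - repeat split; exists (ds x); apply Hs.
  - der s (ds x) Hs.
    ring. }
assert (HG : forall x, is_derive G x (- ds x * F x)).
{ intros x; unfold F, G; auto_derive.
  - repeat split; exists (ds x); apply Hs.
  - der s (ds x) Hs.
    ring. }
assert (HT : forall x, a <= x <= b -> is_derive T x (ds x * (1 + T x ^ 2))).
{ intros x Hx; specialize (Hcos x Hx); unfold T; auto_derive.
  - fold (s x - mid); repeat split; try (exists (ds x); apply Hs); lra.
  - fold (s x - mid); der s (ds x) Hs.
    field_simplify; [| lra | lra]; f_equal; ring. }
assert (HPhi : forall x, a <= x <= b -> is_derive Phi x (e x - k x)).
{ intros x Hx; unfold Phi; auto_derive.
  - repeat split; try (now exists (ds x * G x)); try (now exists (df x));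
      try (now exists (- ds x * F x)).
    exists (ds x * (1 + T x ^ 2)); auto.
  - der T (ds x * (1 + T x ^ 2)) HT.
    der F (ds x * G x) HF.
    der G (- ds x * F x) HG.
    der f (df x) Hf.
    unfold e, k; field; specialize (Hps x); lra. }
assert (Cinv : forall x, continuous (fun x => / ds x) x).
{ intros x; apply continuous_comp; [apply Hcs |].
  apply continuous_Rinv; specialize (Hps x); lra. }
assert (Cf := fun x => continuous_is_derive f df x (Hf x)).
assert (Ce : forall x, continuous e x).
{ intros x; unfold e, Rdiv; cbn [pow]; cont. }
assert (CF := fun x => continuous_is_derive F (fun x => ds x * G x) x (HF x)).
assert (CG := fun x => continuous_is_derive G (fun x => - ds x * F x) x (HG x)).
assert (CT : forall x, a <= x <= b -> continuous T x)
  by (intros x Hx; apply (ex_derive_continuous T); eexists; exact (HT x Hx)).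
assert (Ck : forall x, a <= x <= b -> continuous k x).
{ intros x Hx; specialize (CT x Hx); unfold k, Rdiv; cbn [pow]; cont. }
assert (Xk : ex_RInt k a b).
{ apply (ex_RInt_continuous (V := R_CompleteNormedModule)).
  intros x; rewrite Rmin_left, Rmax_right by lra; auto. }
assert (Xe : ex_RInt e a b)
  by (apply (ex_RInt_continuous (V := R_CompleteNormedModule)); auto).
assert (EI : I - RInt k a b = Phi b - Phi a).
{ transitivity (RInt (fun x => e x - k x) a b).
  - symmetry; apply (RInt_minus (V := R_CompleteNormedModule)); assumption.
  - apply is_RInt_unique, (is_RInt_derive (V := R_CompleteNormedModule)).
    + intros x; rewrite Rmin_left, Rmax_right by lra; auto.
    + intros x; rewrite Rmin_left, Rmax_right by lra; intros Hx.
      apply (continuous_minus (V := R_NormedModule)); auto. }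
(* At both ends [f = F], so only the term [F * G] survives. *)
assert (EJ : Phi b - Phi a = J).
{ unfold Phi, J; fold (F a) (F b) in Ha, Hb; fold (G a) (G b).
  rewrite Ha, Hb; ring. }
assert (Pk : forall x, a <= x <= b -> 0 <= k x).
{ intros x _; unfold k; apply Rmult_le_pos; [apply pow2_ge_0 |].
  left; apply Rinv_0_lt_compat, Hps. }
split.
- assert (0 <= RInt k a b); [| lra].
  apply RInt_ge_0; [lra | exact Xk | intros x Hx; apply Pk; lra].
- intros HIJ.
  assert (Zk : forall x, a <= x <= b -> k x = 0)
    by (apply RInt_le_0_eq_0; auto; lra).
  assert (Z : forall x, a <= x <= b ->
     df x - ds x * G x + T x * ds x * (f x - F x) = 0).
  { intros x Hx; specialize (Zk x Hx); unfold k in Zk; specialize (Hps x).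
    apply Rmult_integral in Zk as [Zk | Zk].
    - simpl in Zk; nra.
    - apply Rinv_neq_0_compat in Zk; [easy | lra]. }
  (* The vanishing square is a first-order linear equation for [f - F], whose solutions are the
     multiples of [cos (s x - mid)]. The quotient [q] is therefore constant, and it is 0 at [a]. *)
  set (q := fun x => (f x - F x) / cos (s x - mid)).
  assert (Hq : forall x, a <= x <= b -> is_derive q x 0).
  { intros x Hx; specialize (Hcos x Hx); specialize (Z x Hx); unfold q; auto_derive.
    - fold (s x - mid); repeat split; try (now exists (ds x * G x)); try (now exists (df x)); try lra.
      now exists (ds x).
    - der F (ds x * G x) HF.
      der f (df x) Hf.
      der s (ds x) Hs.
      fold (s x - mid).
      transitivity ((df x - ds x * G x + T x * ds x * (f x - F x)) / cos (s x - mid)).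
      + unfold T; field; lra.
      + rewrite Z; field; lra. }
  assert (Zg : forall x, a <= x <= b -> f x - F x = 0).
  { intros x Hx.
    assert (Eq : q a = q x).
    { destruct (proj1 Hx) as [H | <-]; [| reflexivity].
      apply (eq_is_derive q a x); [| exact H].
      intros t Ht; apply Hq; lra. }
    assert (E0 : f a - F a = 0) by (unfold F; lra).
    unfold q in Eq; rewrite E0 in Eq; specialize (Hcos x Hx).
    replace (f x - F x) with ((f x - F x) / cos (s x - mid) * cos (s x - mid))
      by (field; lra).
    rewrite <- Eq; unfold Rdiv; ring. }
  intros x Hx; specialize (Zg x Hx); specialize (Z x Hx); rewrite Zg in Z.
  fold (F x) (G x); split; lra.
Qed.

(** On an interval of [s]-length less than [PI] the sine of that length is positive, so Cramer's
    rule finds [A] and [B] from the end values, and the boundary term becomes a quadratic form in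
    [f a] and [f b]. *)
Lemma interval_energy_ends (s ds f df : R -> R) (a b : R) :
  (forall x, is_derive s x (ds x)) -> (forall x, continuous ds x) ->
  (forall x, 0 < ds x) ->
  (forall x, is_derive f x (df x)) -> (forall x, continuous df x) ->
  a < b -> s b - s a < PI ->
  let I := RInt (fun x => df x ^ 2 / ds x - f x ^ 2 * ds x) a b in
  let J := (cos (s b - s a) * (f a ^ 2 + f b ^ 2) - 2 * f a * f b) / sin (s b - s a) in
  J <= I /\
  (I <= J -> exists A B, forall x, a <= x <= b ->
     f x = A * cos (s x) + B * sin (s x)
     /\ df x = ds x * (B * cos (s x) - A * sin (s x))).
Proof.
intros Hs Hcs Hps Hf Hcf Hab Hl I J.
assert (Hl0 : s a < s b) by (apply (is_derive_incr s ds); auto).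
assert (HS : 0 < sin (s b - s a)) by (apply sin_gt_0; lra).
set (A := (f a * sin (s b) - f b * sin (s a)) / sin (s b - s a)).
set (B := (f b * cos (s a) - f a * cos (s b)) / sin (s b - s a)).
assert (HS' := HS); rewrite sin_minus in HS'.
destruct (interval_energy s ds f df A B a b) as [H1 H2]; auto.
- unfold A, B; rewrite sin_minus; field; lra.
- unfold A, B; rewrite sin_minus; field; lra.
- fold I in H1, H2.
  assert (EJ : J = f b * (B * cos (s b) - A * sin (s b))
           - f a * (B * cos (s a) - A * sin (s a))).
  { assert (Ea := proj_eq (s a)); assert (Eb := proj_eq (s b)).
    (* The inserted sums of squares, each equal to 1, homogenize the identity so that [field] can
       check it. *)
    transitivity ((cos (s b - s a) * (f a ^ 2 + f b ^ 2)
      - f a * f b * ((cos (s a) ^ 2 + sin (s a) ^ 2) + (cos (s b) ^ 2 + sin (s b) ^ 2)))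
      / sin (s b - s a)).
    - unfold J; rewrite Ea, Eb; field; lra.
    - unfold A, B; rewrite cos_minus; field; lra. }
  rewrite EJ; split; [exact H1 |].
  intros HI; exists A, B; auto.
Qed.

(** * The hexagonal quadratic form *)

(** The form is the squared modulus of [X - Y e^(i d1) - Z e^(- i d3)]: the angle condition gives
    [cos d2 = - cos (d1 + d3)], which accounts for the product of [Y] and [Z]. *)
Lemma hexagon_form_even (X Y Z d1 d2 d3 : R) : d1 + d2 + d3 = PI ->
  0 <= X ^ 2 + Y ^ 2 + Z ^ 2
       - 2 * cos d1 * X * Y - 2 * cos d2 * Y * Z - 2 * cos d3 * Z * X.
Proof.
intros Hd.
assert (E2 : cos d2 = sin d1 * sin d3 - cos d1 * cos d3).
{ replace d2 with (PI - (d1 + d3)) by lra.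
  rewrite cos_minus, cos_PI, sin_PI, cos_plus; ring. }
assert (E1 := proj_eq d1); assert (E3 := proj_eq d3).
replace (_ - _) with
  ((X - cos d1 * Y - cos d3 * Z) ^ 2 + (sin d1 * Y - sin d3 * Z) ^ 2).
- apply Rplus_le_le_0_compat; apply pow2_ge_0.
- rewrite E2.
  replace (sin d1 * Y - sin d3 * Z) with (sin d1 * Y + - (sin d3 * Z)) by ring.
  transitivity (X ^ 2 + (cos d1 ^ 2 + sin d1 ^ 2) * Y ^ 2
    + (cos d3 ^ 2 + sin d3 ^ 2) * Z ^ 2 - 2 * cos d1 * X * Y
    - 2 * (sin d1 * sin d3 - cos d1 * cos d3) * Y * Z - 2 * cos d3 * Z * X);
  [ring | rewrite E1, E3; ring].
Qed.

(** The last product has the opposite sign because the hexagon closes through the antipode, where an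
    odd quantity changes sign. Under the sign hypotheses each cross term is a nonnegative multiple
    of its cosine. *)
Lemma hexagon_form_odd (X Y Z d1 d2 d3 : R) :
  0 < d1 -> 0 < d2 -> 0 < d3 -> d1 + d2 + d3 = PI ->
  X * Y <= 0 -> Y * Z <= 0 -> 0 <= Z * X ->
  0 <= X ^ 2 + Y ^ 2 + Z ^ 2
       - 2 * cos d1 * X * Y - 2 * cos d2 * Y * Z + 2 * cos d3 * Z * X.
Proof.
intros H1 H2 H3 Hd HXY HYZ HZX.
assert (B1 := COS_bound d1); assert (B2 := COS_bound d2); assert (B3 := COS_bound d3).
assert (Hpos : forall d, 0 < d -> d <= PI / 2 -> 0 <= cos d)
  by (intros d Hd1 Hd2; apply cos_ge_0; lra).
replace (_ + _) with (X ^ 2 + Y ^ 2 + Z ^ 2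
  + 2 * cos d1 * (- (X * Y)) + 2 * cos d2 * (- (Y * Z)) + 2 * cos d3 * (Z * X)) by ring.
(* At most one angle is obtuse, and AM-GM absorbs its term. *)
destruct (Rle_dec d1 (PI / 2)) as [A1 | A1];
[ destruct (Rle_dec d2 (PI / 2)) as [A2 | A2];
  [ destruct (Rle_dec d3 (PI / 2)) as [A3 | A3] |] |].
- assert (C1 := Hpos d1 H1 A1); assert (C2 := Hpos d2 H2 A2); assert (C3 := Hpos d3 H3 A3).
  assert (0 <= cos d1 * (- (X * Y))) by (apply Rmult_le_pos; lra).
  assert (0 <= cos d2 * (- (Y * Z))) by (apply Rmult_le_pos; lra).
  assert (0 <= cos d3 * (Z * X)) by (apply Rmult_le_pos; lra).
  generalize (pow2_ge_0 X) (pow2_ge_0 Y) (pow2_ge_0 Z); lra.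
- assert (C1 := Hpos d1 H1 A1); assert (C2 := Hpos d2 H2 A2).
  assert (0 <= cos d1 * (- (X * Y))) by (apply Rmult_le_pos; lra).
  assert (0 <= cos d2 * (- (Y * Z))) by (apply Rmult_le_pos; lra).
  assert (0 <= (1 + cos d3) * (Z * X)) by (apply Rmult_le_pos; lra).
  generalize (pow2_ge_0 (X - Z)) (pow2_ge_0 Y); lra.
- assert (C1 := Hpos d1 H1 A1); assert (C3 := Hpos d3 H3 ltac:(lra)).
  assert (0 <= cos d1 * (- (X * Y))) by (apply Rmult_le_pos; lra).
  assert (0 <= cos d3 * (Z * X)) by (apply Rmult_le_pos; lra).
  assert (0 <= (1 + cos d2) * (- (Y * Z))) by (apply Rmult_le_pos; lra).
  generalize (pow2_ge_0 (Y + Z)) (pow2_ge_0 X); lra.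
- assert (C2 := Hpos d2 H2 ltac:(lra)); assert (C3 := Hpos d3 H3 ltac:(lra)).
  assert (0 <= cos d2 * (- (Y * Z))) by (apply Rmult_le_pos; lra).
  assert (0 <= cos d3 * (Z * X)) by (apply Rmult_le_pos; lra).
  assert (0 <= (1 + cos d1) * (- (X * Y))) by (apply Rmult_le_pos; lra).
  generalize (pow2_ge_0 (X + Y)) (pow2_ge_0 Z); lra.
Qed.

(** The energy of the solution of [h'' + h = 0] over a time [l] whose end vectors have moduli [a],
    [b] and enclose the angle [d]. *)
Definition chord (l d a b : R) : R :=
  (cos l * (a ^ 2 + b ^ 2) - 2 * a * b * cos d) / sin l.

(** Adds the two diagonal coefficients that adjacent arcs contribute at their common vertex. *)
Lemma cot_plus_cot (l l' l'' : R) :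
  0 < l -> 0 < l' -> 0 < l'' -> l + l' + l'' = PI ->
  cos l / sin l + cos l' / sin l' = sin l'' / (sin l * sin l').
Proof.
intros H H' H'' Hl.
assert (0 < sin l) by (apply sin_gt_0; lra).
assert (0 < sin l') by (apply sin_gt_0; lra).
replace l'' with (PI - (l + l')) by lra.
rewrite sin_PI_x, sin_plus; field; lra.
Qed.

(** Passing to the sums [a + b] and the differences [a - b] decouples the form into the parts
    handled by [hexagon_form_even] and [hexagon_form_odd]. *)
Lemma hexagon_ge_0 (l1 l2 l3 d1 d2 d3 a1 a2 a3 b1 b2 b3 : R) :
  0 < l1 -> 0 < l2 -> 0 < l3 -> l1 + l2 + l3 = PI ->
  0 < d1 -> 0 < d2 -> 0 < d3 -> d1 + d2 + d3 = PI ->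
  (a1 - b1) * (a2 - b2) <= 0 -> (a2 - b2) * (a3 - b3) <= 0 ->
  0 <= (a3 - b3) * (a1 - b1) ->
  0 <= chord l1 d1 a1 a2 + chord l2 d2 a2 a3 + chord l3 d3 a3 b1
       + chord l1 d1 b1 b2 + chord l2 d2 b2 b3 + chord l3 d3 b3 a1.
Proof.
intros Hl1 Hl2 Hl3 Hl Hd1 Hd2 Hd3 Hd H12 H23 H31.
assert (S1 : 0 < sin l1) by (apply sin_gt_0; lra).
assert (S2 : 0 < sin l2) by (apply sin_gt_0; lra).
assert (S3 : 0 < sin l3) by (apply sin_gt_0; lra).
assert (E1 := cot_plus_cot l3 l1 l2 Hl3 Hl1 Hl2 ltac:(lra)).
assert (E2 := cot_plus_cot l1 l2 l3 Hl1 Hl2 Hl3 ltac:(lra)).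
assert (E3 := cot_plus_cot l2 l3 l1 Hl2 Hl3 Hl1 ltac:(lra)).
(* Each vertex is weighted by the sine of the arc length not adjacent to it. By [cot_plus_cot] all
   squares then have coefficient 1 once the form is multiplied by
   [2 * (sin l1 * sin l2 * sin l3)]. *)
set (X := sin l2 * (a1 + b1)); set (Y := sin l3 * (a2 + b2)); set (Z := sin l1 * (a3 + b3)).
set (X' := sin l2 * (a1 - b1)); set (Y' := sin l3 * (a2 - b2)); set (Z' := sin l1 * (a3 - b3)).
assert (P1 := hexagon_form_even X Y Z d1 d2 d3 Hd).
assert (S23 := Rmult_lt_0_compat _ _ S2 S3).
assert (S13 := Rmult_lt_0_compat _ _ S1 S3).
assert (S12 := Rmult_lt_0_compat _ _ S1 S2).
assert (P2 : 0 <= X' ^ 2 + Y' ^ 2 + Z' ^ 2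
  - 2 * cos d1 * X' * Y' - 2 * cos d2 * Y' * Z' + 2 * cos d3 * Z' * X').
{ apply hexagon_form_odd; auto; unfold X', Y', Z'.
  - replace (_ * _) with ((sin l2 * sin l3) * ((a1 - b1) * (a2 - b2))) by ring; nra.
  - replace (_ * _) with ((sin l1 * sin l3) * ((a2 - b2) * (a3 - b3))) by ring; nra.
  - replace (_ * _) with ((sin l1 * sin l2) * ((a3 - b3) * (a1 - b1))) by ring; nra. }
apply Rle_trans with (((X ^ 2 + Y ^ 2 + Z ^ 2
       - 2 * cos d1 * X * Y - 2 * cos d2 * Y * Z - 2 * cos d3 * Z * X)
  + (X' ^ 2 + Y' ^ 2 + Z' ^ 2
  - 2 * cos d1 * X' * Y' - 2 * cos d2 * Y' * Z' + 2 * cos d3 * Z' * X'))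
  / (2 * (sin l1 * sin l2 * sin l3))).
{ apply Rmult_le_pos; [lra |].
  left; apply Rinv_0_lt_compat; nra. }
right; symmetry.
transitivity ((cos l3 / sin l3 + cos l1 / sin l1) * (a1 ^ 2 + b1 ^ 2)
  + (cos l1 / sin l1 + cos l2 / sin l2) * (a2 ^ 2 + b2 ^ 2)
  + (cos l2 / sin l2 + cos l3 / sin l3) * (a3 ^ 2 + b3 ^ 2)
  - 2 * cos d1 / sin l1 * (a1 * a2 + b1 * b2)
  - 2 * cos d2 / sin l2 * (a2 * a3 + b2 * b3)
  - 2 * cos d3 / sin l3 * (a3 * b1 + b3 * a1)).
{ unfold chord; field; lra. }
rewrite E1, E2, E3; unfold X, Y, Z, X', Y', Z'; field; lra.
Qed.

(** * Planar curves of unit areal speed *)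

Record circle_lift (s ds : R -> R) : Prop := {
  lift_derive : forall x, is_derive s x (ds x);
  lift_cont : forall x, continuous ds x;
  lift_pos : forall x, 0 < ds x;
  lift_shift : forall x, s (x + 2 * PI) = s x + 2 * PI
}.

(* [m] is the modulus of the planar curve [m e^(i th)] whose areal speed,
   measured in the time [s], equals 1. *)
Record polar_frame (s ds th dth m dm : R -> R) : Prop := {
  frame_time : circle_lift s ds;
  frame_angle : circle_lift th dth;
  frame_modulus : forall x, is_derive m x (dm x);
  frame_modulus_cont : forall x, continuous dm x;
  frame_modulus_pos : forall x, 0 < m x;
  frame_area : forall x, m x ^ 2 * dth x = ds x
}.

(** The density [|dh/ds|^2 - |h|^2] against [ds], for [h = m e^(i th)], pulled back to the common
    parameter [x]. *)
Definition frame_energy (ds dth m dm : R -> R) (x : R) : R :=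
  (dm x ^ 2 + m x ^ 2 * dth x ^ 2) / ds x - m x ^ 2 * ds x.

(** The derivative is recorded along with the value so that a single point determines [A] and [B];
    solutions on adjacent arcs can then be glued at their common endpoint. *)
Definition frame_linear (s ds f df : R -> R) (A B x : R) : Prop :=
  f x = A * cos (s x) + B * sin (s x)
  /\ df x = ds x * (B * cos (s x) - A * sin (s x)).

Lemma frame_linear_unique (s ds f df : R -> R) (A B A' B' x : R) :
  0 < ds x -> frame_linear s ds f df A B x -> frame_linear s ds f df A' B' x ->
  A = A' /\ B = B'.
Proof.
intros Hd [H1 H2] [H3 H4].
rewrite H3 in H1; rewrite H4 in H2; apply Rmult_eq_reg_l in H2; [| lra].
assert (E := proj_eq (s x)).
set (c := cos (s x)) in *; set (t := sin (s x)) in *.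
split; apply Rminus_diag_uniq.
- transitivity ((A - A') * (c ^ 2 + t ^ 2)); [rewrite E; ring |].
  transitivity (c * ((A * c + B * t) - (A' * c + B' * t))
    - t * ((B * c - A * t) - (B' * c - A' * t))); [ring | rewrite H1, H2; ring].
- transitivity ((B - B') * (c ^ 2 + t ^ 2)); [rewrite E; ring |].
  transitivity (t * ((A * c + B * t) - (A' * c + B' * t))
    + c * ((B * c - A * t) - (B' * c - A' * t))); [ring | rewrite H1, H2; ring].
Qed.

Lemma frame_linear_glue (s ds f df : R -> R) (a b c : R) :
  (forall x, 0 < ds x) -> a <= b -> b <= c ->
  (exists A B, forall x, a <= x <= b -> frame_linear s ds f df A B x) ->
  (exists A B, forall x, b <= x <= c -> frame_linear s ds f df A B x) ->
  exists A B, forall x, a <= x <= c -> frame_linear s ds f df A B x.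
Proof.
intros Hd Hab Hbc (A & B & H1) (A' & B' & H2).
exists A, B; intros x Hx.
destruct (frame_linear_unique s ds f df A B A' B' b) as [E1 E2]; auto.
- apply H1; lra.
- apply H2; lra.
- destruct (Rle_dec x b); [apply H1; lra |].
  rewrite E1, E2; apply H2; lra.
Qed.

Lemma lift_derive_shift (g dg : R -> R) (c d : R) :
  (forall x, is_derive g x (dg x)) -> (forall x, g (x + c) = g x + d) ->
  forall x, dg (x + c) = dg x.
Proof.
intros Hg E x.
assert (H1 : is_derive (fun y => g (y + c)) x (dg (x + c))).
{ auto_derive; [exists (dg (x + c)); apply Hg |].
  der g (dg (x + c)) Hg; ring. }
assert (H2 : is_derive (fun y => g (y + c)) x (dg x)).
{ apply (is_derive_ext (fun y => g y + d)); [intros t; now rewrite E |].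
  auto_derive; [exists (dg x); apply Hg |].
  der g (dg x) Hg; ring. }
rewrite <- (is_derive_unique _ _ _ H1); apply is_derive_unique; exact H2.
Qed.

Section Frame.

Context (s ds th dth m dm : R -> R) (HF : polar_frame s ds th dth m dm).

Let fu (x : R) : R := m x * cos (th x).
Let fv (x : R) : R := m x * sin (th x).
Let dfu (x : R) : R := dm x * cos (th x) - m x * dth x * sin (th x).
Let dfv (x : R) : R := dm x * sin (th x) + m x * dth x * cos (th x).

Let Hs := lift_derive _ _ (frame_time _ _ _ _ _ _ HF).
Let Hds := lift_cont _ _ (frame_time _ _ _ _ _ _ HF).
Let Ps := lift_pos _ _ (frame_time _ _ _ _ _ _ HF).
Let Sh := lift_shift _ _ (frame_time _ _ _ _ _ _ HF).
Let Ht := lift_derive _ _ (frame_angle _ _ _ _ _ _ HF).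
Let Hdt := lift_cont _ _ (frame_angle _ _ _ _ _ _ HF).
Let Pt := lift_pos _ _ (frame_angle _ _ _ _ _ _ HF).
Let Th := lift_shift _ _ (frame_angle _ _ _ _ _ _ HF).
Let Hm := frame_modulus _ _ _ _ _ _ HF.
Let Hdm := frame_modulus_cont _ _ _ _ _ _ HF.
Let Pm := frame_modulus_pos _ _ _ _ _ _ HF.
Let Ha := frame_area _ _ _ _ _ _ HF.

Let Cm : forall x, continuous m x :=
  fun x => continuous_is_derive m dm x (Hm x).
Let Cth : forall x, continuous th x :=
  fun x => continuous_is_derive th dth x (Ht x).

Lemma frame_derive_x (x : R) : is_derive fu x (dfu x).
Proof.
unfold fu, dfu; auto_derive.
- repeat split; [exists (dm x) | exists (dth x)]; auto.
- der m (dm x) Hm; der th (dth x) Ht; ring.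
Qed.

Lemma frame_derive_y (x : R) : is_derive fv x (dfv x).
Proof.
unfold fv, dfv; auto_derive.
- repeat split; [exists (dm x) | exists (dth x)]; auto.
- der m (dm x) Hm; der th (dth x) Ht; ring.
Qed.

Lemma frame_cont_x (x : R) : continuous dfu x.
Proof. unfold dfu; cont. Qed.

Lemma frame_cont_y (x : R) : continuous dfv x.
Proof. unfold dfv; cont. Qed.

Let Cinv (x : R) : continuous (fun y => / ds y) x.
Proof.
apply continuous_comp; [apply Hds |].
apply continuous_Rinv; specialize (Ps x); lra.
Qed.

Lemma frame_energy_cont (x : R) : continuous (frame_energy ds dth m dm) x.
Proof. unfold frame_energy, Rdiv; cbn [pow]; cont. Qed.

Lemma frame_energy_split (x : R) :
  frame_energy ds dth m dm x
  = (dfu x ^ 2 / ds x - fu x ^ 2 * ds x) + (dfv x ^ 2 / ds x - fv x ^ 2 * ds x).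
Proof.
transitivity ((dm x ^ 2 + m x ^ 2 * dth x ^ 2) * (cos (th x) ^ 2 + sin (th x) ^ 2) / ds x
  - m x ^ 2 * (cos (th x) ^ 2 + sin (th x) ^ 2) * ds x).
- rewrite proj_eq; unfold frame_energy; specialize (Ps x); field; lra.
- unfold dfu, fu, dfv, fv; specialize (Ps x); field; lra.
Qed.

(** The scalar bound applies to each Cartesian coordinate of [h], and the law of cosines combines
    the two boundary terms into a [chord]. Equality in the sum forces equality in both summands. *)
Lemma frame_interval (a b : R) : a < b -> s b - s a < PI ->
  let I := RInt (frame_energy ds dth m dm) a b in
  let J := chord (s b - s a) (th b - th a) (m a) (m b) in
  J <= I /\
  (I <= J ->
   (exists A B, forall x, a <= x <= b -> frame_linear s ds fu dfu A B x) /\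
   (exists A B, forall x, a <= x <= b -> frame_linear s ds fv dfv A B x)).
Proof.
intros Hab Hl I J.
assert (Hl0 : s a < s b) by (apply (is_derive_incr s ds); auto).
assert (HS : 0 < sin (s b - s a)) by (apply sin_gt_0; lra).
destruct (interval_energy_ends s ds fu dfu a b Hs Hds Ps frame_derive_x frame_cont_x Hab Hl)
  as [U1 U2].
destruct (interval_energy_ends s ds fv dfv a b Hs Hds Ps frame_derive_y frame_cont_y Hab Hl)
  as [V1 V2].
assert (EI : I = RInt (fun x => dfu x ^ 2 / ds x - fu x ^ 2 * ds x) a b
               + RInt (fun x => dfv x ^ 2 / ds x - fv x ^ 2 * ds x) a b).
{ unfold I; rewrite (RInt_ext _ _ _ _ (fun x _ => frame_energy_split x)).
  assert (Cfu := fun x => continuous_is_derive fu dfu x (frame_derive_x x)).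
  assert (Cfv := fun x => continuous_is_derive fv dfv x (frame_derive_y x)).
  assert (Cdu := frame_cont_x); assert (Cdv := frame_cont_y).
  apply (RInt_plus (V := R_CompleteNormedModule));
    apply (ex_RInt_continuous (V := R_CompleteNormedModule)); intros x _;
    unfold Rdiv; cbn [pow]; cont. }
assert (EJ : J = (cos (s b - s a) * (fu a ^ 2 + fu b ^ 2) - 2 * fu a * fu b) / sin (s b - s a)
  + (cos (s b - s a) * (fv a ^ 2 + fv b ^ 2) - 2 * fv a * fv b) / sin (s b - s a)).
{ transitivity ((cos (s b - s a) * (m a ^ 2 * (cos (th a) ^ 2 + sin (th a) ^ 2)
    + m b ^ 2 * (cos (th b) ^ 2 + sin (th b) ^ 2))
    - 2 * m a * m b * cos (th b - th a)) / sin (s b - s a)).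
  - rewrite !proj_eq; unfold J, chord; field; lra.
  - rewrite cos_minus with (x := th b); unfold fu, fv; field; lra. }
cbv zeta in U1, U2, V1, V2.
split; [lra |].
intros HI; split; [apply U2 | apply V2]; lra.
Qed.

(** The ratio [ds / dth] is periodic, and [m] is its positive square root. *)
Lemma frame_modulus_shift (x : R) : m (x + 2 * PI) = m x.
Proof.
assert (E1 := Ha (x + 2 * PI)); assert (E2 := Ha x).
rewrite (lift_derive_shift s ds _ _ Hs Sh), (lift_derive_shift th dth _ _ Ht Th), <- E2 in E1.
apply Rmult_eq_reg_r in E1; [| specialize (Pt x); lra].
assert (P1 := Pm x); assert (P2 := Pm (x + 2 * PI)).
nra.
Qed.

Lemma frame_energy_shift (x : R) :
  frame_energy ds dth m dm (x + 2 * PI) = frame_energy ds dth m dm x.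
Proof.
unfold frame_energy.
rewrite (lift_derive_shift s ds _ _ Hs Sh), (lift_derive_shift th dth _ _ Ht Th),
  frame_modulus_shift.
rewrite (lift_derive_shift m dm (2 * PI) 0 Hm); [reflexivity |].
intros y; rewrite frame_modulus_shift; ring.
Qed.

(** The integrand is the derivative of the scalar product of [h] and [dh/ds], which takes the same
    value at both ends of a period. *)
Lemma frame_energy_linear (A B C D : R) :
  (forall x, m x * cos (th x) = A * cos (s x) + B * sin (s x)) ->
  (forall x, m x * sin (th x) = C * cos (s x) + D * sin (s x)) ->
  RInt (frame_energy ds dth m dm) 0 (2 * PI) = 0.
Proof.
intros Hu Hv.
set (P := fun x => (A * cos (s x) + B * sin (s x)) * (B * cos (s x) - A * sin (s x))
  + (C * cos (s x) + D * sin (s x)) * (D * cos (s x) - C * sin (s x))).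
assert (HP : forall x, is_derive P x (frame_energy ds dth m dm x)).
{ intros x.
  assert (Eu : dfu x = ds x * (B * cos (s x) - A * sin (s x))).
  { rewrite <- (is_derive_unique _ _ _ (frame_derive_x x)).
    apply is_derive_unique, (is_derive_ext (fun y => A * cos (s y) + B * sin (s y)));
      [intros t; symmetry; apply Hu |].
    auto_derive; [repeat split; exists (ds x); auto | der s (ds x) Hs; ring]. }
  assert (Ev : dfv x = ds x * (D * cos (s x) - C * sin (s x))).
  { rewrite <- (is_derive_unique _ _ _ (frame_derive_y x)).
    apply is_derive_unique, (is_derive_ext (fun y => C * cos (s y) + D * sin (s y)));
      [intros t; symmetry; apply Hv |].
    auto_derive; [repeat split; exists (ds x); auto | der s (ds x) Hs; ring]. }
  rewrite frame_energy_split, Eu, Ev; unfold fu, fv; rewrite Hu, Hv.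
  unfold P; auto_derive; [repeat split; exists (ds x); auto |].
  der s (ds x) Hs; specialize (Ps x); field; lra. }
change (RInt (frame_energy ds dth m dm) 0 (2 * PI) = 0 :> R).
transitivity (P (2 * PI) - P 0).
- apply is_RInt_unique, (is_RInt_derive (V := R_CompleteNormedModule)); intros x _;
    [apply HP | apply frame_energy_cont].
- replace (2 * PI) with (0 + 2 * PI) by ring.
  unfold P; rewrite !Sh, !cos_plus, !sin_plus, cos_2PI, sin_2PI; ring.
Qed.

(** Balance gives opposite arcs the same [s]-length and the same angle, so the six chord values add
    up to the form of [hexagon_ge_0]. *)
Lemma frame_energy_ge_0 (x1 x2 x3 : R) :
  x1 < x2 -> x2 < x3 -> x3 < x1 + PI ->
  (forall x, x = x1 \/ x = x2 \/ x = x3 ->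
     s (x + PI) = s x + PI /\ th (x + PI) = th x + PI) ->
  (m x1 - m (x1 + PI)) * (m x2 - m (x2 + PI)) <= 0 ->
  (m x2 - m (x2 + PI)) * (m x3 - m (x3 + PI)) <= 0 ->
  0 <= (m x3 - m (x3 + PI)) * (m x1 - m (x1 + PI)) ->
  let E := RInt (frame_energy ds dth m dm) 0 (2 * PI) in
  0 <= E /\
  (E = 0 -> exists A B C D, A * D - B * C = 1 /\
     forall x, x1 <= x <= x1 + 2 * PI ->
       m x * cos (th x) = A * cos (s x) + B * sin (s x)
       /\ m x * sin (th x) = C * cos (s x) + D * sin (s x)).
Proof.
intros H12 H23 H31 Hbal M12 M23 M31 E.
destruct (Hbal x1 ltac:(auto)) as [S1 T1]; destruct (Hbal x2 ltac:(auto)) as [S2 T2];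
  destruct (Hbal x3 ltac:(auto)) as [S3 T3].
assert (S1' : s (x1 + 2 * PI) = s x1 + 2 * PI) by apply Sh.
assert (T1' : th (x1 + 2 * PI) = th x1 + 2 * PI) by apply Th.
assert (Is : forall a b, a < b -> s a < s b)
  by (intros a b Hab; apply (is_derive_incr s ds); auto).
assert (It : forall a b, a < b -> th a < th b)
  by (intros a b Hab; apply (is_derive_incr th dth); auto).
assert (s12 := Is _ _ H12); assert (s23 := Is _ _ H23); assert (s31 := Is _ _ H31).
assert (t12 := It _ _ H12); assert (t23 := It _ _ H23); assert (t31 := It _ _ H31).
(* All six arcs are shorter than [PI] in the time [s], since [s x1 < s x2 < s x3 < s x1 + PI]. *)
destruct (frame_interval x1 x2) as [J1 K1]; [lra | lra |].
destruct (frame_interval x2 x3) as [J2 K2]; [lra | lra |].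
destruct (frame_interval x3 (x1 + PI)) as [J3 K3]; [lra | lra |].
destruct (frame_interval (x1 + PI) (x2 + PI)) as [J4 K4]; [lra | lra |].
destruct (frame_interval (x2 + PI) (x3 + PI)) as [J5 K5]; [lra | lra |].
destruct (frame_interval (x3 + PI) (x1 + 2 * PI)) as [J6 K6]; [lra | lra |].
cbv zeta in J1, J2, J3, J4, J5, J6, K1, K2, K3, K4, K5, K6.
rewrite frame_modulus_shift in J6, K6.
rewrite S1' in J6, K6; rewrite T1' in J6, K6.
rewrite S1 in J3, J4, K3, K4; rewrite T1 in J3, J4, K3, K4.
rewrite S2 in J4, J5, K4, K5; rewrite T2 in J4, J5, K4, K5.
rewrite S3 in J5, J6, K5, K6; rewrite T3 in J5, J6, K5, K6.
replace (s x2 + PI - (s x1 + PI)) with (s x2 - s x1) in J4, K4 by ring.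
replace (th x2 + PI - (th x1 + PI)) with (th x2 - th x1) in J4, K4 by ring.
replace (s x3 + PI - (s x2 + PI)) with (s x3 - s x2) in J5, K5 by ring.
replace (th x3 + PI - (th x2 + PI)) with (th x3 - th x2) in J5, K5 by ring.
replace (s x1 + 2 * PI - (s x3 + PI)) with (s x1 + PI - s x3) in J6, K6 by ring.
replace (th x1 + 2 * PI - (th x3 + PI)) with (th x1 + PI - th x3) in J6, K6 by ring.
assert (HJ := hexagon_ge_0 (s x2 - s x1) (s x3 - s x2) (s x1 + PI - s x3)
  (th x2 - th x1) (th x3 - th x2) (th x1 + PI - th x3)
  (m x1) (m x2) (m x3) (m (x1 + PI)) (m (x2 + PI)) (m (x3 + PI))
  ltac:(lra) ltac:(lra) ltac:(lra) ltac:(lra) ltac:(lra) ltac:(lra) ltac:(lra) ltac:(lra)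
  M12 M23 M31).
assert (Ch : forall a b c, RInt (frame_energy ds dth m dm) a b
  + RInt (frame_energy ds dth m dm) b c = RInt (frame_energy ds dth m dm) a c).
{ intros a b c; apply (RInt_Chasles (V := R_CompleteNormedModule));
    apply (ex_RInt_continuous (V := R_CompleteNormedModule)); intros x _;
    apply frame_energy_cont. }
assert (HE : E = RInt (frame_energy ds dth m dm) x1 (x1 + 2 * PI)).
{ symmetry; apply RInt_periodic; [apply frame_energy_cont | apply frame_energy_shift]. }
rewrite <- (Ch x1 x2), <- (Ch x2 x3), <- (Ch x3 (x1 + PI)), <- (Ch (x1 + PI) (x2 + PI)),
  <- (Ch (x2 + PI) (x3 + PI)) in HE.
split; [lra |].
intros E0.
(* The six lower bounds have a nonnegative sum, so a vanishing total leaves no slack on any arc. *)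
destruct K1 as [U1 V1]; [lra |]; destruct K2 as [U2 V2]; [lra |];
destruct K3 as [U3 V3]; [lra |]; destruct K4 as [U4 V4]; [lra |];
destruct K5 as [U5 V5]; [lra |]; destruct K6 as [U6 V6]; [lra |].
assert (U : exists A B, forall x, x1 <= x <= x1 + 2 * PI -> frame_linear s ds fu dfu A B x).
{ apply (frame_linear_glue s ds fu dfu x1 x2); auto; [lra | lra |].
  apply (frame_linear_glue s ds fu dfu x2 x3); auto; [lra | lra |].
  apply (frame_linear_glue s ds fu dfu x3 (x1 + PI)); auto; [lra | lra |].
  apply (frame_linear_glue s ds fu dfu (x1 + PI) (x2 + PI)); auto; [lra | lra |].
  apply (frame_linear_glue s ds fu dfu (x2 + PI) (x3 + PI)); auto; lra. }
assert (V : exists A B, forall x, x1 <= x <= x1 + 2 * PI -> frame_linear s ds fv dfv A B x).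
{ apply (frame_linear_glue s ds fv dfv x1 x2); auto; [lra | lra |].
  apply (frame_linear_glue s ds fv dfv x2 x3); auto; [lra | lra |].
  apply (frame_linear_glue s ds fv dfv x3 (x1 + PI)); auto; [lra | lra |].
  apply (frame_linear_glue s ds fv dfv (x1 + PI) (x2 + PI)); auto; [lra | lra |].
  apply (frame_linear_glue s ds fv dfv (x2 + PI) (x3 + PI)); auto; lra. }
destruct U as (A & B & U); destruct V as (C & D & V).
exists A, B, C, D; split.
- destruct (U x1) as [F1 F2]; [lra |]; destruct (V x1) as [F3 F4]; [lra |].
  (* The areal speed [fu dfv - fv dfu = m^2 dth] is [ds]. *)
  assert (W : ds x1 * (A * D - B * C) = ds x1 * 1).
  { transitivity (ds x1 * (A * D - B * C) * (cos (s x1) ^ 2 + sin (s x1) ^ 2));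
      [rewrite proj_eq; ring |].
    transitivity (fu x1 * dfv x1 - fv x1 * dfu x1); [rewrite F1, F2, F3, F4; ring |].
    transitivity (m x1 ^ 2 * dth x1 * (cos (th x1) ^ 2 + sin (th x1) ^ 2));
      [unfold fu, fv, dfu, dfv; ring |].
    rewrite proj_eq, Ha; ring. }
  apply Rmult_eq_reg_l in W; [exact W | specialize (Ps x1); lra].
- intros x Hx; split; [apply (U x Hx) | apply (V x Hx)].
Qed.

End Frame.

(** * Balanced points *)

Lemma is_derive_nonpos_right (f : R -> R) (z b l : R) : z < b ->
  is_derive f z l -> f z = 0 -> (forall x, z < x <= b -> f x <= 0) -> l <= 0.
Proof.
intros Hzb Hd Hz Hf; apply Rnot_lt_le; intros Hl.
apply is_derive_Reals in Hd.
destruct (Hd (l / 2) ltac:(lra)) as [d Hlim].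
set (h := Rmin (d / 2) (b - z)); assert (Pd := cond_pos d).
assert (Hh : 0 < h /\ h <= b - z /\ h <= d / 2)
  by (unfold h, Rmin; destruct (Rle_dec (d / 2) (b - z)); lra).
specialize (Hlim h ltac:(lra)); rewrite (Rabs_pos_eq h) in Hlim by lra.
specialize (Hlim ltac:(lra)); apply Rabs_def2 in Hlim; rewrite Hz in Hlim.
specialize (Hf (z + h) ltac:(lra)).
assert (Hi := Rinv_0_lt_compat h ltac:(lra)).
unfold Rdiv in Hlim; nra.
Qed.

(** Here [z] is the supremum of the points of [[a, b]] with positive value, and continuity excludes
    either sign at [z]. The last clause, the leastness of the supremum, supplies a positive value
    after any given point before [z]. *)
Lemma last_positive (f : R -> R) (a b : R) :
  (forall x, continuous f x) -> a < b -> 0 < f a -> f b < 0 ->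
  exists z, a < z < b /\ f z = 0 /\ (forall x, z < x <= b -> f x <= 0) /\
    (forall y, y < z -> exists x, y < x <= z /\ a <= x /\ 0 < f x).
Proof.
intros Hc Hab Ha Hb.
set (E := fun x => a <= x <= b /\ 0 < f x).
destruct (completeness E) as [z [Hz1 Hz2]].
{ exists b; intros x [Hx _]; lra. }
{ exists a; split; [lra | exact Ha]. }
assert (Haz : a <= z) by (apply Hz1; split; [lra | exact Ha]).
assert (Hzb : z <= b) by (apply Hz2; intros x [Hx _]; lra).
assert (Hright : forall x, z < x <= b -> f x <= 0).
{ intros x Hx; apply Rnot_lt_le; intros Hp.
  assert (x <= z) by (apply Hz1; split; [lra | exact Hp]); lra. }
assert (Hleft : forall y, y < z -> exists x, y < x <= z /\ a <= x /\ 0 < f x).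
{ intros y Hy; apply NNPP; intros Hno.
  assert (z <= y); [| lra].
  apply Hz2; intros x Hx; apply Rnot_lt_le; intros Hyx; apply Hno; exists x.
  assert (x <= z) by (apply Hz1; exact Hx).
  destruct Hx; repeat split; lra. }
assert (Hnear : forall e, 0 < e -> exists d, 0 < d /\ forall x, Rabs (x - z) < d ->
  Rabs (f x - f z) < e).
{ intros e He.
  destruct (Hc z _ (locally_ball (f z) (mkposreal e He))) as [d Hd].
  exists d; split; [apply cond_pos | exact Hd]. }
assert (Hfz : f z = 0).
{ apply Rle_antisym; apply Rnot_lt_le; intros Hp.
  - assert (z < b) by (destruct Hzb as [H | H]; [exact H | rewrite H in Hp; lra]).
    destruct (Hnear (f z) Hp) as (d & Pd & Hd).
    set (h := Rmin (d / 2) (b - z)).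
    assert (Hh : 0 < h /\ h <= b - z /\ h <= d / 2)
      by (unfold h, Rmin; destruct (Rle_dec (d / 2) (b - z)); lra).
    specialize (Hd (z + h)); specialize (Hright (z + h) ltac:(lra)).
    replace (z + h - z) with h in Hd by ring; rewrite (Rabs_pos_eq h) in Hd by lra.
    specialize (Hd ltac:(lra)); apply Rabs_def2 in Hd; lra.
  - destruct (Hnear (- f z) ltac:(lra)) as (d & Pd & Hd).
    destruct (Hleft (z - d) ltac:(lra)) as (x & Hx & _ & Hfx).
    assert (Hx' : Rabs (x - z) < d) by (apply Rabs_def1; lra).
    specialize (Hd x Hx'); apply Rabs_def2 in Hd; lra. }
exists z; repeat split; auto.
- destruct Haz as [H | H]; [exact H | rewrite <- H in Hfz; lra].
- destruct Hzb as [H | H]; [exact H | rewrite H in Hfz; lra].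
Qed.

(** To the right of the zero from [last_positive] the function is nonpositive, which bounds the
    difference quotients. The weak sign allows tangential zeros. *)
Lemma crossing_down (f df : R -> R) (a b : R) :
  (forall x, is_derive f x (df x)) -> a < b -> 0 < f a -> f b < 0 ->
  exists z, a < z < b /\ f z = 0 /\ df z <= 0.
Proof.
intros Hd Hab Ha Hb.
destruct (last_positive f a b) as (z & Hz & Hfz & Hr & _); auto.
- intros x; exact (continuous_is_derive f df x (Hd x)).
- exists z; repeat split; try lra.
  apply (is_derive_nonpos_right f z b); auto; lra.
Qed.

Lemma crossing_up (f df : R -> R) (a b : R) :
  (forall x, is_derive f x (df x)) -> a < b -> f a < 0 -> 0 < f b ->
  exists z, a < z < b /\ f z = 0 /\ 0 <= df z.
Proof.
intros Hd Hab Ha Hb.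
destruct (crossing_down (fun x => - f x) (fun x => - df x) a b) as (z & Hz & Hfz & Hdz);
  try lra.
- intros x; apply (is_derive_opp (V := R_NormedModule)); apply Hd.
- exists z; repeat split; lra.
Qed.

(* The defect [tau (x + PI) - tau x - PI] of a balanced [tau] cannot keep a sign
   between two antipodal zeros, because cosine is decreasing on [0, PI]. *)
Lemma balanced_defect_sign (tau w : R -> R) (z : R) : circle_lift tau w ->
  RInt (fun x => cos (tau x)) 0 (2 * PI) = 0 ->
  RInt (fun x => sin (tau x)) 0 (2 * PI) = 0 ->
  tau (z + PI) = tau z + PI ->
  (forall x, z <= x <= z + PI -> tau (x + PI) <= tau x + PI) ->
  forall x, z <= x <= z + PI -> tau (x + PI) = tau x + PI.
Proof.
intros [Hd Hw Pw Sh] HC HS Hz Hle.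
assert (HPI := PI_RGT_0).
assert (Ct := fun x => continuous_is_derive tau w x (Hd x)).
assert (Ct' : forall x, continuous (fun y => tau (y + PI)) x).
{ intros x; apply (continuous_comp (fun y => y + PI) tau); [cont | apply Ct]. }
(* The angles at [x] and, turned back by [PI], at its antipode, both measured from [tau z]. They lie
   in [[0, PI]], and the sign hypothesis says [B <= A]. *)
set (A := fun x => tau x - tau z); set (B := fun x => tau (x + PI) - tau z - PI).
assert (Mono : forall a b, a <= b -> tau a <= tau b).
{ intros a b [H | ->]; [| lra]; left; apply (is_derive_incr tau w); auto. }
assert (HA : forall x, z <= x <= z + PI -> 0 <= A x <= PI).
{ intros x Hx; unfold A.
  assert (H1 := Mono z x ltac:(lra)); assert (H2 := Mono x (z + PI) ltac:(lra)); lra. }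
assert (HB : forall x, z <= x <= z + PI -> 0 <= B x <= PI).
{ intros x Hx; unfold B.
  assert (H1 := Mono (z + PI) (x + PI) ltac:(lra)).
  assert (H2 := Mono (x + PI) (z + 2 * PI) ltac:(lra)); rewrite Sh in H2; lra. }
set (f := fun x => cos (B x) - cos (A x)).
assert (Hf0 : forall x, z <= x <= z + PI -> 0 <= f x).
{ intros x Hx; specialize (HA x Hx); specialize (HB x Hx); specialize (Hle x Hx).
  unfold f; assert (cos (A x) <= cos (B x)); [| lra].
  apply cos_decr_1; try lra; unfold A, B; lra. }
assert (Cf : forall x, continuous f x) by (intros x; unfold f, A, B; cont).
(* The component of the tangent in the direction [tau z], which integrates to 0 over a period. Since
   [k (x + PI) = - cos (B x)], folding the period in half gives a zero integral for [f]. *)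
set (k := fun x => cos (tau x - tau z)).
assert (Ck : forall x, continuous k x) by (intros x; unfold k; cont).
assert (Xk : forall a b, ex_RInt k a b)
  by (intros a b; apply (ex_RInt_continuous (V := R_CompleteNormedModule)); auto).
assert (Ik : RInt k z (z + 2 * PI) = 0).
{ rewrite RInt_periodic; auto.
  - assert (XC : ex_RInt (fun x => cos (tau x)) 0 (2 * PI))
      by (apply (ex_RInt_continuous (V := R_CompleteNormedModule)); intros x _; cont).
    assert (XS : ex_RInt (fun x => sin (tau x)) 0 (2 * PI))
      by (apply (ex_RInt_continuous (V := R_CompleteNormedModule)); intros x _; cont).
    apply (RInt_correct (V := R_CompleteNormedModule)) in XC.
    apply (is_RInt_scal _ _ _ (cos (tau z))) in XC.
    apply (RInt_correct (V := R_CompleteNormedModule)) in XS.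
    apply (is_RInt_scal _ _ _ (sin (tau z))) in XS.
    assert (X := is_RInt_plus _ _ _ _ _ _ XC XS).
    rewrite HC, HS in X.
    apply (is_RInt_ext _ k) in X.
    + apply (is_RInt_unique (V := R_CompleteNormedModule)) in X; rewrite X.
      unfold plus, scal; simpl; unfold mult; simpl; ring.
    + intros x _; unfold k; rewrite cos_minus.
      unfold plus, scal; simpl; unfold mult; simpl; ring.
  - intros x; unfold k; rewrite Sh.
    replace (tau x + 2 * PI - tau z) with (tau x - tau z + 2 * PI) by ring.
    rewrite cos_plus, cos_2PI, sin_2PI; ring. }
assert (If : RInt f z (z + PI) = 0).
{ assert (E1 : RInt k z (z + PI) + RInt k (z + PI) (z + 2 * PI) = RInt k z (z + 2 * PI))
    by (apply (RInt_Chasles (V := R_CompleteNormedModule)); auto).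
  assert (E2 : RInt k (z + PI) (z + 2 * PI) = RInt (fun x => k (x + PI)) z (z + PI)).
  { generalize (RInt_comp_lin (V := R_CompleteNormedModule) k 1 PI z (z + PI)).
    replace (1 * z + PI) with (z + PI) by ring.
    replace (1 * (z + PI) + PI) with (z + 2 * PI) by ring.
    intros E; rewrite <- E by apply Xk.
    apply RInt_ext; intros x _; unfold scal; simpl; unfold mult; simpl.
    now rewrite !Rmult_1_l. }
  transitivity (- (RInt k z (z + PI) + RInt (fun x => k (x + PI)) z (z + PI)));
    [| rewrite <- E2; lra].
  rewrite <- (RInt_plus (V := R_CompleteNormedModule)); [| apply Xk |].
  - rewrite <- (RInt_opp (V := R_CompleteNormedModule)).
    + apply RInt_ext; intros x _; unfold f, k, A, B, opp, plus; simpl.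
      replace (tau (x + PI) - tau z - PI) with (tau (x + PI) - tau z + - PI) by ring.
      rewrite (cos_plus _ (- PI)), cos_neg, sin_neg, cos_PI, sin_PI; ring.
    + apply (ex_RInt_continuous (V := R_CompleteNormedModule)); intros x _.
      unfold plus; simpl; unfold k; cont.
  - apply (ex_RInt_continuous (V := R_CompleteNormedModule)); intros x _.
    unfold k; cont. }
intros x Hx.
assert (Zf : f x = 0) by (apply (RInt_le_0_eq_0 f z (z + PI)); auto; lra).
assert (EAB : B x = A x).
{ apply cos_inj; auto; unfold f in Zf; lra. }
unfold A, B in EAB; lra.
Qed.

(** The defect [g] is antiperiodic under [PI]. If it is positive at [c], it has the sign pattern
    [+ - + -] along [[c, c + PI]], and the three sign changes give crossings downwards, upwards and
    downwards. *)
Lemma balanced_triple (tau w : R -> R) : circle_lift tau w ->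
  RInt (fun x => cos (tau x)) 0 (2 * PI) = 0 ->
  RInt (fun x => sin (tau x)) 0 (2 * PI) = 0 ->
  exists x1 x2 x3, x1 < x2 /\ x2 < x3 /\ x3 < x1 + PI /\
    (forall x, x = x1 \/ x = x2 \/ x = x3 -> tau (x + PI) = tau x + PI) /\
    w (x1 + PI) <= w x1 /\ w x2 <= w (x2 + PI) /\ w (x3 + PI) <= w x3.
Proof.
intros HL HC HS; assert (HL' := HL); destruct HL' as [Hd Hw Pw Sh].
assert (HPI := PI_RGT_0).
set (g := fun x => tau (x + PI) - tau x - PI).
set (dg := fun x => w (x + PI) - w x).
assert (Hg : forall x, is_derive g x (dg x)).
{ intros x; unfold g, dg; auto_derive.
  - repeat split; [exists (w (x + PI)) | exists (w x)]; auto.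
  - replace (Derive (fun y => tau y) (x + PI)) with (w (x + PI))
      by (symmetry; apply is_derive_unique, Hd).
    replace (Derive (fun y => tau y) x) with (w x)
      by (symmetry; apply is_derive_unique, Hd).
    ring. }
assert (Anti : forall x, g (x + PI) = - g x).
{ intros x; unfold g.
  replace (x + PI + PI) with (x + 2 * PI) by ring; rewrite Sh; ring. }
destruct (classic (exists c, 0 < g c)) as [[c Hc] | Hno].
- assert (Hpat : exists v u, c < v /\ v < u /\ u < c + PI /\ g v < 0 /\ 0 < g u).
  { destruct (last_positive g c (c + PI)) as (z & Hz & Hgz & Hr & Hl); try lra.
    - intros x; exact (continuous_is_derive g dg x (Hg x)).
    - rewrite Anti; lra.
    - destruct (classic (exists v, c < v < z /\ g v < 0)) as [(v & Hv & Hgv) | Hn].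
      + destruct (Hl v ltac:(lra)) as (u & Hu & _ & Hgu).
        exists v, u; repeat split; lra.
      (* Otherwise [g] is nonnegative on [[c, z]] and nonpositive on [[z, c + PI]], hence by
         antiperiodicity nonpositive on [[z, z + PI]]. Then [balanced_defect_sign] makes it vanish
         at [c + PI], where its value is [- g c < 0]. *)
      + exfalso.
        assert (Hpos : forall x, c <= x <= z -> 0 <= g x).
        { intros x Hx; apply Rnot_lt_le; intros Hneg.
          destruct (Req_dec x c) as [-> | Hxc]; [lra |].
          destruct (Req_dec x z) as [-> | Hxz]; [lra |].
          apply Hn; exists x; lra. }
        assert (Hgc : tau (c + PI + PI) = tau (c + PI) + PI).
        { apply (balanced_defect_sign tau w z HL HC HS); [unfold g in Hgz; lra | | lra].
          intros x Hx; assert (g x <= 0); [| unfold g in *; lra].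
          destruct (Rle_dec x z) as [H1 | H1]; [replace x with z by lra; lra |].
          destruct (Rle_dec x (c + PI)) as [H2 | H2]; [apply Hr; lra |].
          replace x with (x - PI + PI) by ring; rewrite Anti.
          specialize (Hpos (x - PI) ltac:(lra)); lra. }
        assert (g (c + PI) = 0) by (unfold g; lra).
        rewrite Anti in *; lra. }
  destruct Hpat as (v & u & H1 & H2 & H3 & Hv & Hu).
  destruct (crossing_down g dg c v) as (x1 & B1 & Z1 & D1); auto.
  destruct (crossing_up g dg v u) as (x2 & B2 & Z2 & D2); auto.
  destruct (crossing_down g dg u (c + PI)) as (x3 & B3 & Z3 & D3); auto;
    [rewrite Anti; lra |].
  exists x1, x2, x3; unfold dg in *.
  repeat split; try lra.
  intros x [-> | [-> | ->]]; unfold g in *; lra.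
- assert (Zg : forall x, g x = 0).
  { intros x; apply Rle_antisym; apply Rnot_lt_le; intros H; apply Hno;
      [now exists x | exists (x + PI); rewrite Anti; lra]. }
  assert (Zd : forall x, dg x = 0).
  { intros x; rewrite <- (is_derive_unique _ _ _ (Hg x)).
    rewrite (Derive_ext _ (fun _ => 0)); [apply Derive_const | auto]. }
  (* The defect vanishes identically, so any three increasing points within a length less than [PI]
     serve; here [2 < PI]. *)
  exists 0, 1, 2.
  assert (P2 := PI2_1).
  repeat split; try lra.
  + intros x _; specialize (Zg x); unfold g in Zg; lra.
  + specialize (Zd 0); unfold dg in Zd; lra.
  + specialize (Zd 1); unfold dg in Zd; lra.
  + specialize (Zd 2); unfold dg in Zd; lra.
Qed.

(** * Curves *)

(** A continuous angle stays within [PI / 2] of [tau x] near [x], so there it equals [tau x] plus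
    the arctangent of a rational expression in [c] and [s], which can be differentiated. *)
Lemma is_derive_lift (tau c s : R -> R) (x lc ls : R) :
  (forall y, cos (tau y) = c y) -> (forall y, sin (tau y) = s y) ->
  continuous tau x -> is_derive c x lc -> is_derive s x ls ->
  is_derive tau x (c x * ls - s x * lc).
Proof.
intros Ec Es Ct Hc Hs.
apply (is_derive_ext_loc (fun y => tau x
  + atan ((s y * c x - c y * s x) / (c y * c x + s y * s x)))).
- destruct (Ct _ (locally_ball (tau x) (mkposreal 1 Rlt_0_1))) as [d Hd].
  exists d; intros y Hy; specialize (Hd y Hy).
  change (Rabs (tau y - tau x) < 1) in Hd; apply Rabs_def2 in Hd.
  assert (P2 := PI2_1).
  rewrite <- !Ec, <- !Es, <- sin_minus, <- cos_minus.
  change (tau x + atan (tan (tau y - tau x)) = tau y :> R).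
  rewrite atan_tan; [ring | lra].
- assert (N : c x * c x + s x * s x = 1)
    by (rewrite <- Ec, <- Es; generalize (proj_eq (tau x)); simpl; lra).
  auto_derive.
  + repeat split; try (now exists ls); try (now exists lc); lra.
  + replace (Derive (fun y => s y) x) with ls
      by (symmetry; now apply is_derive_unique).
    replace (Derive (fun y => c y) x) with lc
      by (symmetry; now apply is_derive_unique).
    replace ((s x * c x + - (c x * s x))) with 0 by ring.
    rewrite N; field.
Qed.

Lemma curve_tangent_lift (sigma : degree_one_curve) : strictly_convex sigma ->
  exists tau w dw : R -> R,
    circle_lift tau w /\ (forall x, is_derive w x (dw x)) /\
    (forall x, continuous dw x) /\
    (forall x, proj (tau x) = tangent sigma (proj x)).
Proof.
intros (G & [HGx HGy] & HGT & _).
destruct (tangent_degree sigma) as (tau & Ct & Hlift & Hdeg).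
destruct (tangent_smooth sigma) as [HC HS].
set (C := fun t => px (tangent sigma (proj t))) in *.
set (S := fun t => py (tangent sigma (proj t))) in *.
assert (EC : forall y, cos (tau y) = C y) by (intros y; exact (f_equal px (Hlift y))).
assert (ES : forall y, sin (tau y) = S y) by (intros y; exact (f_equal py (Hlift y))).
assert (D : forall f n, (forall k x, ex_derive_n f k x) ->
  forall x, is_derive (Derive_n f n) x (Derive_n f (Datatypes.S n) x)).
{ intros f n Hf x; apply Derive_correct; exact (Hf (Datatypes.S n) x). }
set (w := fun x => C x * Derive_n S 1 x - S x * Derive_n C 1 x).
(* The products of the two first derivatives cancel in the derivative of [w]. *)
set (dw := fun x => C x * Derive_n S 2 x - S x * Derive_n C 2 x).
assert (Dt : forall x, is_derive tau x (w x)).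
{ intros x; apply is_derive_lift; auto; [exact (D C 0%nat HC x) | exact (D S 0%nat HS x)]. }
assert (Dw : forall x, is_derive w x (dw x)).
{ intros x; unfold w, dw.
  assert (C0 := D C 0%nat HC x); assert (C1 := D C 1%nat HC x).
  assert (S0 := D S 0%nat HS x); assert (S1 := D S 1%nat HS x).
  change (Derive_n C 0) with C in C0; change (Derive_n S 0) with S in S0.
  set (c1 := Derive_n C 1) in *; set (s1 := Derive_n S 1) in *; clearbody c1 s1.
  auto_derive.
  - repeat split; eexists; eassumption.
  - der C (c1 x) C0; der S (s1 x) S0.
    der c1 (Derive_n C 2 x) C1; der s1 (Derive_n S 2 x) S1; ring. }
assert (Cn : forall f n, (forall k x, ex_derive_n f k x) -> forall x,
  continuous (Derive_n f n) x).
{ intros f n Hf x; apply (continuous_is_derive _ _ _ (D f n Hf x)). }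
assert (Cw : forall x, continuous w x)
  by (intros x; exact (continuous_is_derive w dw x (Dw x))).
assert (Cdw : forall x, continuous dw x).
{ intros x.
  assert (C0 := Cn C 0%nat HC x); assert (C2 := Cn C 2%nat HC x).
  assert (S0 := Cn S 0%nat HS x); assert (S2 := Cn S 2%nat HS x).
  change (Derive_n C 0) with C in C0; change (Derive_n S 0) with S in S0.
  unfold dw; set (c2 := Derive_n C 2) in *; set (s2 := Derive_n S 2) in *; cont. }
assert (Sh : forall x, tau (x + 2 * PI) = tau x + 2 * PI)
  by (intros x; rewrite Hdeg; ring).
(* Differentiating [G (T p) = p] shows that the angular speed has no zero. *)
assert (Nz : forall x, w x <> 0).
{ intros x Hw.
  assert (Ex : forall y, px (G (proj (tau y))) = cos y) by (intros y; now rewrite Hlift, HGT).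
  assert (Ey : forall y, py (G (proj (tau y))) = sin y) by (intros y; now rewrite Hlift, HGT).
  assert (Gx := Derive_correct _ _ (HGx 1%nat (tau x))).
  assert (Gy := Derive_correct _ _ (HGy 1%nat (tau x))).
  assert (Z := Dt x); rewrite Hw in Z.
  assert (Hsin := is_derive_comp _ tau x _ _ Gx Z).
  assert (Hcos := is_derive_comp _ tau x _ _ Gy Z).
  apply is_derive_ext with (g := cos) in Hsin; [| exact Ex].
  apply is_derive_ext with (g := sin) in Hcos; [| exact Ey].
  assert (E1 := is_derive_unique _ _ _ Hsin); assert (E2 := is_derive_unique _ _ _ Hcos).
  rewrite (is_derive_unique _ _ _ (is_derive_cos x)) in E1.
  rewrite (is_derive_unique _ _ _ (is_derive_sin x)) in E2.
  unfold scal in E1, E2; simpl in E1, E2; unfold mult in E1, E2; simpl in E1, E2.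
  rewrite Rmult_0_l in E1, E2.
  generalize (proj_eq x); simpl; nra. }
(* Degree one makes [tau] increase by [2 * PI] over a period, so [w] is positive somewhere; a
   nonpositive value elsewhere would produce a zero. *)
assert (Pw : forall x, 0 < w x).
{ assert (HPI := PI_RGT_0).
  destruct (MVT_gen tau 0 (2 * PI) w) as (c & _ & Ec).
  { intros x _; apply Dt. }
  { intros x _; apply continuity_pt_filterlim, Ct. }
  assert (Hc : 0 < w c).
  { replace (2 * PI) with (0 + 2 * PI) in Ec by ring; rewrite Sh in Ec; nra. }
  intros x; apply Rnot_le_lt; intros Hx.
  destruct (IVT_gen w c x 0) as (y & _ & Hy).
  - intros y; apply continuity_pt_filterlim, Cw.
  - rewrite Rmin_right, Rmax_left by lra; lra.
  - exact (Nz y Hy). }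
exists tau, w, dw; split; [split; auto | auto].
Qed.

Lemma proj_in_period (a : R) (p : S1) : exists x, a <= x <= a + 2 * PI /\ proj x = p.
Proof.
assert (HPI := PI_RGT_0).
assert (Hz : forall k : Z, forall x, proj (x + 2 * PI * IZR k) = proj x).
{ assert (H1 : forall x, proj (x + 2 * PI) = proj x).
  { intros x; apply S1_ext; simpl; rewrite ?cos_plus, ?sin_plus, cos_2PI, sin_2PI; ring. }
  apply (Z.peano_ind (fun k => forall x, proj (x + 2 * PI * IZR k) = proj x)).
  - intros x; f_equal; ring.
  - intros k IH x; rewrite succ_IZR.
    replace (x + 2 * PI * (IZR k + 1)) with (x + 2 * PI * IZR k + 2 * PI) by ring.
    now rewrite H1.
  - intros k IH x; rewrite <- Z.sub_1_r, minus_IZR, <- H1.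
    replace (x + 2 * PI * (IZR k - 1) + 2 * PI) with (x + 2 * PI * IZR k) by ring.
    apply IH. }
set (r := (a - theta p) / (2 * PI)).
destruct (archimed r) as [A1 A2].
(* The integer [up r] exceeds [r] by at most 1, so the shifted angle lies in [(a, a + 2 * PI]]. *)
exists (theta p + 2 * PI * IZR (up r)); split.
- assert (E : a = theta p + 2 * PI * r) by (unfold r; field; lra).
  split; nra.
- rewrite Hz; apply proj_theta.
Qed.

(** * The energies of a curve as frame energies, and ovals as linear images of the circle *)

Section Curve.

Context (sigma : degree_one_curve) (tau w dw : R -> R) (HL : circle_lift tau w).
Context (Dw : forall x, is_derive w x (dw x)) (Cdw : forall x, continuous dw x).
Context (Hlift : forall x, proj (tau x) = tangent sigma (proj x)).

Let L := arclength sigma.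
Let PL : 0 < L := arclength_pos sigma.
Let Dt := lift_derive _ _ HL.
Let Cw := lift_cont _ _ HL.
Let Pw := lift_pos _ _ HL.
Let Sh := lift_shift _ _ HL.

Lemma curvature_proj (x : R) : curvature sigma (proj x) = 2 * PI / L * w x.
Proof.
unfold curvature; fold L.
rewrite (pullback_dtheta_lift (tangent sigma) tau) by (auto; exists (w x); apply Dt).
now rewrite (is_derive_unique _ _ _ (Dt x)).
Qed.

Lemma dtheta_curvature_proj (x : R) :
  dtheta (curvature sigma) (proj x) = 2 * PI / L * dw x.
Proof.
rewrite dtheta_proj, (Derive_ext _ (fun t => 2 * PI / L * w t)) by apply curvature_proj.
rewrite Derive_scal, (is_derive_unique _ _ _ (Dw x)); reflexivity.
Qed.

Lemma frame_E_G : polar_frame (fun x => x) (fun _ => 1) tau w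
  (fun x => / sqrt (w x)) (fun x => - dw x / (2 * w x * sqrt (w x))).
Proof.
assert (Sq : forall x, 0 < sqrt (w x)) by (intros x; apply sqrt_lt_R0, Pw).
assert (Sq2 : forall x, sqrt (w x) * sqrt (w x) = w x)
  by (intros x; apply sqrt_sqrt; left; apply Pw).
split; auto.
- split; intros x; [apply (is_derive_id (K := R_AbsRing)) | apply continuous_const | lra | ring].
- intros x; specialize (Pw x); specialize (Sq x); specialize (Sq2 x); auto_derive.
  + repeat split; try lra; now exists (dw x).
  + der w (dw x) Dw; set (q := sqrt (w x)) in *; rewrite <- Sq2; field; lra.
- intros x; unfold Rdiv; cont.
  apply (continuous_comp (fun y => 2 * w y * sqrt (w y)) Rinv).
  + cont.
  + apply continuous_Rinv; specialize (Pw x); specialize (Sq x).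
    apply Rgt_not_eq; nra.
- intros x; now apply Rinv_0_lt_compat.
- intros x; specialize (Sq x); rewrite <- (Sq2 x) at 2; field; lra.
Qed.

Lemma frame_E_G_star : polar_frame tau w (fun x => x) (fun _ => 1)
  (fun x => sqrt (w x)) (fun x => dw x / (2 * sqrt (w x))).
Proof.
assert (Sq : forall x, 0 < sqrt (w x)) by (intros x; apply sqrt_lt_R0, Pw).
split; auto.
- split; intros x; [apply (is_derive_id (K := R_AbsRing)) | apply continuous_const | lra | ring].
- intros x; specialize (Pw x); specialize (Sq x); auto_derive.
  + repeat split; try lra; now exists (dw x).
  + der w (dw x) Dw; field; lra.
- intros x; unfold Rdiv; cont.
  apply (continuous_comp (fun y => 2 * sqrt (w y)) Rinv).
  + cont.
  + apply continuous_Rinv; specialize (Sq x); lra.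
- intros x; rewrite Rmult_1_r; apply pow2_sqrt; left; apply Pw.
Qed.

(** All factors of the length cancel. The angular term of the frame energy is [w], whose integral
    [2 * PI] is the constant added in [E_G]. *)
Lemma E_G_frame_energy : E_G sigma =
  RInt (frame_energy (fun _ => 1) w (fun x => / sqrt (w x))
    (fun x => - dw x / (2 * w x * sqrt (w x)))) 0 (2 * PI).
Proof.
assert (HPI := PI_RGT_0).
assert (Iw : is_RInt w 0 (2 * PI) (2 * PI)).
{ replace (2 * PI) with (tau (2 * PI) - tau 0) at 2.
  - apply (is_RInt_derive (V := R_CompleteNormedModule)); intros x _; auto.
  - replace (2 * PI) with (0 + 2 * PI) at 1 by ring; rewrite Sh; ring. }
set (e := frame_energy _ _ _ _).
assert (Xe : ex_RInt e 0 (2 * PI)).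
{ apply (ex_RInt_continuous (V := R_CompleteNormedModule)); intros x _.
  exact (frame_energy_cont _ _ _ _ _ _ frame_E_G x). }
unfold E_G, curve_integral; fold L.
rewrite (RInt_ext _ (fun x => e x - w x)).
- assert (H : is_RInt (fun x => e x - w x) 0 (2 * PI) (RInt e 0 (2 * PI) - 2 * PI)).
  { apply (is_RInt_minus (V := R_NormedModule)); [| exact Iw].
    exact (RInt_correct (V := R_CompleteNormedModule) _ _ _ Xe). }
  rewrite (is_RInt_unique (V := R_CompleteNormedModule) _ _ _ _ H); lra.
- intros x _.
  unfold grad_norm; rewrite Rpow_mult_distr, pow2_abs, dtheta_curvature_proj, curvature_proj.
  fold L; unfold e, frame_energy.
  assert (Pwx := Pw x); assert (Sq := sqrt_lt_R0 _ Pwx).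
  eq_in_R; transitivity (dw x ^ 2 / (4 * w x ^ 2 * w x) - 1 / w x); [field; lra |].
  set (q := sqrt (w x)) in *.
  replace (w x) with (q * q) by (apply sqrt_sqrt; lra).
  field; lra.
Qed.

(** Here the angular term of the frame energy is the constant 1; its integral, scaled by
    [2 * PI / L], is the constant added in [E_G_star]. *)
Lemma E_G_star_frame_energy : E_G_star sigma = 2 * PI / L *
  RInt (frame_energy w (fun _ => 1) (fun x => sqrt (w x))
    (fun x => dw x / (2 * sqrt (w x)))) 0 (2 * PI).
Proof.
assert (HPI := PI_RGT_0).
set (e := frame_energy _ _ _ _).
assert (Xe : ex_RInt e 0 (2 * PI)).
{ apply (ex_RInt_continuous (V := R_CompleteNormedModule)); intros x _.
  exact (frame_energy_cont _ _ _ _ _ _ frame_E_G_star x). }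
unfold E_G_star, curve_integral; fold L.
transitivity (RInt (fun x => 2 * PI / L * (e x - 1)) 0 (2 * PI) + (2 * PI) ^ 2 / L).
- f_equal; apply RInt_ext; intros x _.
  unfold grad_norm; rewrite Rpow_mult_distr, pow2_abs, dtheta_curvature_proj, curvature_proj.
  fold L; unfold e, frame_energy.
  assert (Pwx := Pw x); assert (Sq := sqrt_lt_R0 _ Pwx).
  rewrite pow2_sqrt by lra.
  eq_in_R; transitivity (2 * PI / L * (dw x ^ 2 / (4 * w x) / w x - w x ^ 2)); [field; lra |].
  rewrite <- (sqrt_sqrt (w x)) at 1 by lra.
  field; lra.
- assert (H : is_RInt (fun x => 2 * PI / L * (e x - 1)) 0 (2 * PI)
    (2 * PI / L * (RInt e 0 (2 * PI) - (2 * PI - 0) * 1))).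
  { apply (is_RInt_scal (V := R_NormedModule)).
    apply (is_RInt_minus (V := R_NormedModule)).
    - exact (RInt_correct (V := R_CompleteNormedModule) _ _ _ Xe).
    - exact (is_RInt_const (V := R_NormedModule) 0 (2 * PI) 1). }
  rewrite (is_RInt_unique (V := R_CompleteNormedModule) _ _ _ _ H); field; lra.
Qed.

Lemma closed_curve_lift : closed_curve sigma ->
  RInt (fun x => cos (tau x)) 0 (2 * PI) = 0
  /\ RInt (fun x => sin (tau x)) 0 (2 * PI) = 0.
Proof.
assert (HPI := PI_RGT_0).
intros Hcl; unfold closed_curve, curve_map in Hcl; fold L in Hcl.
assert (PC : 0 < L / (2 * PI)) by (apply Rdiv_lt_0_compat; lra).
rewrite !RInt_point in Hcl; injection Hcl as H1 H2.
change zero with 0 in H1, H2.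
split.
- rewrite (RInt_ext _ (fun x => px (tangent sigma (proj x))))
    by (intros x _; exact (f_equal px (Hlift x))).
  nra.
- rewrite (RInt_ext _ (fun x => py (tangent sigma (proj x))))
    by (intros x _; exact (f_equal py (Hlift x))).
  nra.
Qed.

(* The rotation [T0_inv] turns the matrix with rows (A, B), (C, D) into the one
   with rows (C, D), (- A, - B). *)
Lemma mobius_of_linear (A B C D a : R) : A * D - B * C = 1 ->
  (forall x, a <= x <= a + 2 * PI -> exists k, 0 < k /\
     k * cos (tau x) = A * cos x + B * sin x /\
     k * sin (tau x) = C * cos x + D * sin x) ->
  mobius (induced_map sigma).
Proof.
intros Hdet Hk.
assert (Hdet' : C * - B - D * - A = 1) by lra.
exists (mkSL2 C D (- A) (- B) Hdet'); intros p.
destruct (proj_in_period a p) as (x & Hx & <-).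
destruct (Hk x Hx) as (k & Pk & E1 & E2).
assert (N : act_norm (mkSL2 C D (- A) (- B) Hdet') (proj x) = k).
{ unfold act_norm, act_x, act_y; simpl px; simpl py; simpl m11; simpl m12; simpl m21; simpl m22.
  rewrite <- E2.
  replace (- A * cos x + - B * sin x) with (- (k * cos (tau x))) by (rewrite E1; ring).
  replace (_ + _) with (k ^ 2 * (cos (tau x) ^ 2 + sin (tau x) ^ 2)) by ring.
  rewrite proj_eq, Rmult_1_r; apply sqrt_pow2; lra. }
unfold induced_map, T0_inv, Gamma; rewrite <- Hlift; apply S1_ext; simpl px; simpl py; rewrite N.
- unfold act_x; simpl; rewrite <- E2; field; lra.
- unfold act_y; simpl.
  replace (- A * cos x + - B * sin x) with (- (k * cos (tau x))) by (rewrite E1; ring).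
  field; lra.
Qed.

(** After undoing the quarter turn [T0_inv], the image of the unit circle is [k e^(i tau)] with [k]
    the norm of the image vector. A matrix of determinant 1 preserves areal speed, so
    [k ^ 2 * w = 1]. *)
Lemma linear_of_mobius : mobius (induced_map sigma) ->
  exists A B C D, A * D - B * C = 1 /\ forall x,
    / sqrt (w x) * cos (tau x) = A * cos x + B * sin x /\
    / sqrt (w x) * sin (tau x) = C * cos x + D * sin x.
Proof.
intros [M HM].
set (A := - m21 M); set (B := - m22 M); set (C := m11 M); set (D := m12 M).
assert (Hdet : A * D - B * C = 1) by (generalize (SL2_det M); unfold A, B, C, D; lra).
set (U := fun x => A * cos x + B * sin x); set (V := fun x => C * cos x + D * sin x).
set (k := fun x => act_norm M (proj x)).
assert (K : forall x, 0 < k x /\ k x * cos (tau x) = U x /\ k x * sin (tau x) = V x).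
{ intros x.
  assert (Hnz : 0 < k x).
  { unfold k, act_norm; apply sqrt_lt_R0.
    assert (Hn := Gamma_eq M (proj x)).
    (* Since [sqrt] is 0 on nonpositive numbers and [/ 0 = 0], the identity [Gamma_eq] would read
       [0 = 1]. *)
    apply Rnot_le_lt; intros Hle; unfold act_norm in Hn; rewrite sqrt_neg_0 in Hn by exact Hle.
    unfold Rdiv in Hn; rewrite Rinv_0 in Hn; lra. }
  assert (E := HM (proj x)); unfold induced_map, T0_inv, Gamma in E; rewrite <- Hlift in E.
  assert (Ex := f_equal px E); assert (Ey := f_equal py E); simpl px in Ex, Ey; simpl py in Ex, Ey.
  fold (k x) in Ex, Ey; repeat split; [exact Hnz | |].
  - replace (cos (tau x)) with (- (act_y M (proj x) / k x)) by lra.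
    unfold act_y, U, A, B; simpl; field; lra.
  - rewrite Ex; unfold act_x, V, C, D; simpl; field; lra. }
(* Differentiating [U sin tau = V cos tau] gives [k^2 w = 1]. *)
assert (Kw : forall x, k x ^ 2 * w x = 1).
{ intros x; destruct (K x) as (Pk & E1 & E2).
  assert (Z : is_derive (fun y => U y * sin (tau y) - V y * cos (tau y)) x 0).
  { apply (is_derive_ext (fun _ => 0)); [| apply (is_derive_const (V := R_NormedModule))].
    intros y; destruct (K y) as (_ & F1 & F2); rewrite <- F1, <- F2; eq_in_R; ring. }
  assert (Z' : is_derive (fun y => U y * sin (tau y) - V y * cos (tau y)) x
    ((B * cos x - A * sin x) * sin (tau x) + U x * (w x * cos (tau x))
     - ((D * cos x - C * sin x) * cos (tau x) - V x * (w x * sin (tau x))))).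
  { unfold U, V; auto_derive; [repeat split; exists (w x); auto |].
    der tau (w x) Dt; ring. }
  apply is_derive_unique in Z; apply is_derive_unique in Z'; rewrite Z in Z'.
  assert (W : U x * (D * cos x - C * sin x) - V x * (B * cos x - A * sin x) = 1).
  { transitivity ((A * D - B * C) * (cos x ^ 2 + sin x ^ 2));
      [unfold U, V; ring | rewrite proj_eq, Hdet; ring]. }
  rewrite <- E1, <- E2 in W, Z'.
  transitivity (k x * w x * k x * (cos (tau x) ^ 2 + sin (tau x) ^ 2));
    [rewrite proj_eq; ring |].
  rewrite <- W.
  transitivity (k x * (k x * cos (tau x) * (w x * cos (tau x))
    + k x * sin (tau x) * (w x * sin (tau x)))); [ring |].
  replace (k x * cos (tau x) * (w x * cos (tau x))
    + k x * sin (tau x) * (w x * sin (tau x)))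
    with ((D * cos x - C * sin x) * cos (tau x) - (B * cos x - A * sin x) * sin (tau x)) by lra.
  ring. }
exists A, B, C, D; split; [exact Hdet |]; intros x.
destruct (K x) as (Pk & E1 & E2).
assert (Ek : / sqrt (w x) = k x).
{ replace (w x) with ((/ k x) ^ 2).
  - rewrite sqrt_pow2 by (left; now apply Rinv_0_lt_compat); apply Rinv_inv.
  - rewrite <- (Rmult_1_l (w x)).
    replace 1 with ((/ k x) ^ 2 * k x ^ 2) by (field; lra).
    rewrite Rmult_assoc, Kw; ring. }
rewrite Ek; auto.
Qed.

End Curve.

(** * Both inequalities and their equality cases, from the two frames of one curve *)

Theorem theorem1p1 (sigma : degree_one_curve)
  (hconv : strictly_convex sigma) (hclosed : closed_curve sigma) :
  (E_G sigma >= 0 /\ (E_G sigma = 0 <-> oval sigma)) /\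
  (E_G_star sigma >= 0 /\ (E_G_star sigma = 0 <-> oval sigma)).
Proof.
destruct (curve_tangent_lift sigma hconv) as (tau & w & dw & HL & Dw & Cdw & Hlift).
destruct (closed_curve_lift sigma tau Hlift hclosed) as [HC HS].
destruct (balanced_triple tau w HL HC HS)
  as (x1 & x2 & x3 & H12 & H23 & H31 & Hbal & W1 & W2 & W3).
assert (Pw := lift_pos _ _ HL).
assert (Sq : forall x, 0 < sqrt (w x)) by (intros x; apply sqrt_lt_R0, Pw).
assert (Hsq : forall x y, w x <= w y -> sqrt (w x) <= sqrt (w y))
  by (intros x y; apply sqrt_le_1_alt).
assert (Hinv : forall x y, w x <= w y -> / sqrt (w y) <= / sqrt (w x))
  by (intros x y H; apply Rinv_le_contravar; auto).
(* The modulus is [/ sqrt w] for [E_G] and [sqrt w] for [E_G_star]. The first reverses all three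
   comparisons and the second keeps them, so the differences alternate in sign either way. *)
assert (S1 := Hsq _ _ W1); assert (S2 := Hsq _ _ W2); assert (S3 := Hsq _ _ W3).
assert (I1 := Hinv _ _ W1); assert (I2 := Hinv _ _ W2); assert (I3 := Hinv _ _ W3).
assert (PC : 0 < 2 * PI / arclength sigma).
{ apply Rdiv_lt_0_compat; [generalize PI_RGT_0; lra | apply arclength_pos]. }
split.
- rewrite (E_G_frame_energy sigma tau w dw HL Dw Cdw Hlift).
  assert (F := frame_E_G tau w dw HL Dw Cdw).
  destruct (frame_energy_ge_0 _ _ _ _ _ _ F x1 x2 x3) as [G1 G2]; auto; try nra.
  split; [apply Rle_ge, G1 |]; split.
  + intros E0; split; [exact hconv |].
    destruct (G2 E0) as (A & B & C & D & Hdet & Hlin).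
    apply (mobius_of_linear sigma tau Hlift A B C D x1 Hdet).
    intros x Hx; exists (/ sqrt (w x)); split; [now apply Rinv_0_lt_compat | auto].
  + intros [_ Hm].
    destruct (linear_of_mobius sigma tau w HL Hlift Hm) as (A & B & C & D & _ & Hlin).
    apply (frame_energy_linear _ _ _ _ _ _ F A B C D); intros x; apply Hlin.
- rewrite (E_G_star_frame_energy sigma tau w dw HL Dw Cdw Hlift).
  assert (F := frame_E_G_star tau w dw HL Dw Cdw).
  destruct (frame_energy_ge_0 _ _ _ _ _ _ F x1 x2 x3) as [G1 G2]; auto; try nra.
  split; [apply Rle_ge, Rmult_le_pos; [lra | exact G1] |]; split.
  + intros E0; split; [exact hconv |].
    apply Rmult_integral in E0 as [E0 | E0]; [lra |].
    destruct (G2 E0) as (A & B & C & D & Hdet & Hlin).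
    (* Time and angle are exchanged here: the matrix sends [e^(i tau)] to [sqrt w e^(i x)]. Its
       inverse, with rows [(D, - B)] and [(- C, A)] by [Hdet], sends [e^(i x)] to
       [e^(i tau) / sqrt w]. *)
    apply (mobius_of_linear sigma tau Hlift D (- B) (- C) A x1); [lra |].
    intros x Hx; exists (/ sqrt (w x)); specialize (Hlin x Hx) as [L1 L2]; specialize (Sq x).
    split; [now apply Rinv_0_lt_compat |]; split;
      apply Rmult_eq_reg_l with (sqrt (w x)); try lra.
    * transitivity ((A * D - B * C) * cos (tau x)); [rewrite Hdet; field; lra |].
      transitivity (D * (sqrt (w x) * cos x) - B * (sqrt (w x) * sin x));
        [rewrite L1, L2; ring | ring].
    * transitivity ((A * D - B * C) * sin (tau x)); [rewrite Hdet; field; lra |].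
      transitivity (A * (sqrt (w x) * sin x) - C * (sqrt (w x) * cos x));
        [rewrite L1, L2; ring | ring].
  + intros [_ Hm].
    destruct (linear_of_mobius sigma tau w HL Hlift Hm) as (A & B & C & D & Hdet & Hlin).
    (* The inverse matrix again, now to express [sqrt w e^(i x)] through [e^(i tau)]. *)
    rewrite (frame_energy_linear _ _ _ _ _ _ F D (- B) (- C) A); [ring | |];
      intros x; destruct (Hlin x) as [L1 L2]; specialize (Sq x);
      replace (cos (tau x)) with (sqrt (w x) * (A * cos x + B * sin x))
        by (rewrite <- L1; field; lra);
      replace (sin (tau x)) with (sqrt (w x) * (C * cos x + D * sin x))
        by (rewrite <- L2; field; lra).
    * transitivity (sqrt (w x) * ((A * D - B * C) * cos x)); [rewrite Hdet; ring | ring].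
    * transitivity (sqrt (w x) * ((A * D - B * C) * sin x)); [rewrite Hdet; ring | ring].
Qed.
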